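(* Let $R$ be a commutative ring which is either an elementary divisor ring or an almost local-global coherent Prüfer ring. Let $M$ be a finitely presented $R$-module and set $\mu=\mu(M)$. Then the determinant map $(m_1,\dots,m_\mu)\mapsto m_1\wedge\cdots\wedge m_\mu$ induces a bijection from $V_\mu(M)/\mathrm{SL}_\mu(R)$ onto $V_1(\det(M))$. In addition, the group $\mathrm{SL}_n(R)$ acts transitively on $V_n(M)$ for every $n>\mu$.
   Context: All rings are commutative with identity. For a finitely generated $R$-module $M$, $\mu(M)$ is the minimal number of generators of $M$; for $n\ge\mu(M)$, $V_n(M)\subseteq M^n$ is the set of $n$-tuples whose components generate $M$. The group $\mathrm{GL}_n(R)$ and its subgroups act on $V_n(M)$ by matrix right-multiplication (elements of $M^n$ are viewed as row vectors). $\mathrm{SL}_n(R)$ is the group of $n\times n$ matrices over $R$ of determinant $1$. The determinant of $M$ is $\det(M)=\bigwedge^{\mu}M$ with $\mu=\mu(M)$; it is a cyclic $R$-module, and $V_1(\det(M))$ is the set of its single generators. A ring $R$ is an elementary divisor ring if for every $m\times n$ matrix $A$ over $R$ there are $B\in\mathrm{GL}_m(R)$, $C\in\mathrm{GL}_n(R)$ such that $BAC$ is diagonal with diagonal coefficients $d_1,\dots,d_k$ satisfying $d_{i+1}\mid d_i$ for $1\le i\le k-1$. A ring is reduced if it has no non-zero nilpotent element; it is arithmetic if its finitely generated ideals are locally principal; a Prüfer ring is a reduced arithmetic ring; a ring is coherent if its finitely generated ideals are finitely presented. (A coherent Prüfer ring is the same as a semihereditary ring.) A ring $R$ is local-global (LG)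 if every (possibly multivariate) polynomial over $R$ whose values generate the ideal $R$ takes a unit as a value. A ring $R$ is almost local-global if $R/Rr$ is local-global for every regular element (non-zero-divisor) $r\in R$.
   Formalization: The bijection is stated for μ(M) > 0, i.e. M ≠ 0: for M = 0 over Z, V_0(M)/SL_0(Z) is one point while det(M) = Z has the two generators ±1; the transitivity part keeps M = 0. *)

(* Defs.v *)
From HB Require Import structures.
From mathcomp Require Import all_boot all_order all_algebra ring.
From mathcomp Require Import boolp classical_sets functions.
From mathcomp Require Import finmap monalg.

Set Implicit Arguments.
Unset Strict Implicit.
Unset Printing Implicit Defensive.

Import GRing.Theory.
Local Open Scope ring_scope.
Local Open Scope quotient_scope.
Local Open Scope classical_set_scope.

(* Commutative rings are comPzRingType throughout, so that the zero ring is
   included (it occurs as R/Rr when r is a unit). *)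

Section Span.
Context (R : pzRingType) (V : lmodType R).

Definition span (A : set V) : set V :=
  [set x | exists k (c : 'I_k -> R) (v : 'I_k -> V),
     (forall i, A (v i)) /\ x = \sum_(i < k) c i *: v i].

Lemma span_inc (A : set V) x : A x -> span A x.
Proof.
move=> Ax; exists 1%N, (fun=> 1), (fun=> x); split=> //.
by rewrite big_ord1 scale1r.
Qed.

Lemma span0 (A : set V) : span A 0.
Proof.
by exists 0%N, (fun=> 0), (fun=> 0); split=> [[]//|]; rewrite big_ord0.
Qed.

Lemma spanZ (A : set V) a x : span A x -> span A (a *: x).
Proof.
move=> [k [c [v [Av ->]]]]; exists k, (fun i => a * c i), v; split=> //.
by rewrite scaler_sumr; apply: eq_bigr => i _; rewrite scalerA.
Qed.

Lemma spanD (A : set V) x y : span A x -> span A y -> span A (x + y).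
Proof.
move=> [k [c [v [Av ->]]]] [l [d [w [Aw ->]]]].
pose glue T (f : 'I_k -> T) (g : 'I_l -> T) i :=
  match fintype.split i with inl j => f j | inr j => g j end.
exists (k + l)%N, (glue _ c d), (glue _ v w); split.
  by move=> i; rewrite /glue; case: fintype.split.
rewrite big_split_ord /=; congr (_ + _); apply: eq_bigr => i _.
  by rewrite /glue -/(unsplit (inl i)) unsplitK.
by rewrite /glue -/(unsplit (inr i)) unsplitK.
Qed.

Definition span_pred (A : set V) : {pred V} := fun x => `[< span A x >].

Lemma span_predP (A : set V) x : reflect (span A x) (x \in span_pred A).
Proof. exact: asboolP. Qed.

Fact span_pred_zmod_closed A : zmod_closed (span_pred A).
Proof.
split=> [|x y /span_predP sx /span_predP sy]; apply/span_predP.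
  exact: span0.
by rewrite -scaleN1r; apply/spanD/spanZ.
Qed.

HB.instance Definition _ A :=
  GRing.isZmodClosed.Build V (span_pred A) (span_pred_zmod_closed A).

End Span.

Section QuotientModule.
Context (R : pzRingType) (V : lmodType R) (A : set V).

Definition quot_lmod := Quotient.quot (span_pred A).

HB.instance Definition _ := GRing.Zmodule.on quot_lmod.
HB.instance Definition _ := Quotient.on quot_lmod.

Lemma quot_lmodE (x y : V) :
  (\pi_quot_lmod x == \pi_quot_lmod y) = (x - y \in span_pred A).
Proof. by rewrite (Quotient.idealrBE (span_pred A)). Qed.

Definition quot_scale (a : R) (x : quot_lmod) : quot_lmod :=
  \pi_quot_lmod (a *: repr x).

Lemma quot_scaleE a x : quot_scale a (\pi_quot_lmod x) = \pi_quot_lmod (a *: x).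
Proof.
apply/eqP; rewrite quot_lmodE -scalerBr; apply/span_predP/spanZ/span_predP.
by rewrite -quot_lmodE reprK.
Qed.

Lemma quot_addE x y :
  \pi_quot_lmod x + \pi_quot_lmod y = \pi_quot_lmod (x + y).
Proof. by have := Quotient.pi_add (span_pred A) x y => /= ->. Qed.

Fact quot_scaleA a b x : quot_scale a (quot_scale b x) = quot_scale (a * b) x.
Proof. by rewrite -[x]reprK (quot_scaleE b) !quot_scaleE scalerA. Qed.

Fact quot_scale1 : left_id 1 quot_scale.
Proof. by move=> x; rewrite -[x]reprK quot_scaleE scale1r. Qed.

Fact quot_scaleDr : right_distributive quot_scale +%R.
Proof.
move=> a x y; rewrite -[x]reprK -[y]reprK.
by rewrite quot_addE !(quot_scaleE a) quot_addE scalerDr.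
Qed.

Fact quot_scaleDl x : {morph quot_scale^~ x : a b / a + b}.
Proof. by move=> a b; rewrite -[x]reprK (quot_scaleE a) (quot_scaleE b) quot_scaleE
  quot_addE scalerDl. Qed.

HB.instance Definition _ := GRing.Zmodule_isLmodule.Build R quot_lmod
  quot_scaleA quot_scale1 quot_scaleDr quot_scaleDl.

End QuotientModule.

Definition ideal_gen (R : comPzRingType) (A : set R) : set R :=
  span (A : set R^o).

Section QuotientRing.
Context (R : comPzRingType) (A : set R).

Definition quot_ring := Quotient.quot (span_pred (A : set R^o)).

HB.instance Definition _ := GRing.Zmodule.on quot_ring.
HB.instance Definition _ := Quotient.on quot_ring.

Definition quot_class (x : R) : quot_ring := \pi_quot_ring (x : R^o).

Lemma quot_ringE (x y : R) :
  (quot_class x == quot_class y) = (x - y \in span_pred (A : set R^o)).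
Proof. by rewrite (Quotient.idealrBE (span_pred (A : set R^o))). Qed.

Lemma quot_classK (x : quot_ring) : quot_class (repr x) = x.
Proof. exact: reprK. Qed.

Definition quot_one : quot_ring := quot_class 1.

Definition quot_mul (x y : quot_ring) : quot_ring :=
  quot_class ((repr x : R) * repr y).

Lemma quot_mulE (x y : R) :
  quot_mul (quot_class x) (quot_class y) = quot_class (x * y).
Proof.
have modP (z : R) :
    span (A : set R^o) ((repr (quot_class z) : R) - z : R^o).
  by apply/span_predP; rewrite -quot_ringE quot_classK.
apply/eqP; rewrite quot_ringE; apply/span_predP.
set x' : R := repr (quot_class x); set y' : R := repr (quot_class y).
have -> : x' * y' - x * y = y' * (x' - x) + x * (y' - y).
  by rewrite !mulrBr [y' * x']mulrC [y' * x]mulrC addrA subrK.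
apply: spanD.
  exact: (spanZ (V := R^o) y' (modP x)).
exact: (spanZ (V := R^o) x (modP y)).
Qed.

Lemma quot_ring_addE (x y : R) :
  quot_class x + quot_class y = quot_class (x + y).
Proof. exact: (esym (Quotient.pi_add (span_pred (A : set R^o)) x y)). Qed.

Fact quot_mulA : associative quot_mul.
Proof.
by move=> x y z; rewrite -(quot_classK x) -(quot_classK y) -(quot_classK z)
  !quot_mulE mulrA.
Qed.

Fact quot_mulC : commutative quot_mul.
Proof.
by move=> x y; rewrite -(quot_classK x) -(quot_classK y) !quot_mulE mulrC.
Qed.

Fact quot_mul1 : left_id quot_one quot_mul.
Proof. by move=> x; rewrite -(quot_classK x) quot_mulE mul1r. Qed.

Fact quot_mulDl : left_distributive quot_mul +%R.
Proof.
move=> x y z; rewrite -(quot_classK x) -(quot_classK y) -(quot_classK z).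
by rewrite !(quot_mulE, quot_ring_addE) mulrDl.
Qed.

HB.instance Definition _ := GRing.Zmodule_isComPzRing.Build quot_ring
  quot_mulA quot_mulC quot_mul1 quot_mulDl.

End QuotientRing.

Record prime_ideal (R : comPzRingType) := PrimeIdeal {
  prime_set :> set R;
  prime_ideal0 : prime_set 0;
  prime_idealD : forall x y, prime_set x -> prime_set y -> prime_set (x + y);
  prime_idealMl : forall a x, prime_set x -> prime_set (a * x);
  prime_ideal1 : ~ prime_set 1;
  prime_idealM : forall x y, prime_set (x * y) -> prime_set x \/ prime_set y
}.

Section Localization.
Context (R : comPzRingType) (P : prime_ideal R).

Definition denom := {s : R | s \notin (P : set R)}.

Lemma denomP s : (s \notin (P : set R)) <-> ~ prime_set P s.
Proof. by split=> [/negP sP Ps|sP]; [apply/sP/mem_set | apply/negP=> /set_mem]. Qed.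

Definition dval (s : denom) : R := val s.

Fact denom1_subproof : 1 \notin (P : set R).
Proof. by apply/denomP/prime_ideal1. Qed.
Definition denom1 : denom := Sub 1 denom1_subproof.

Fact denomM_subproof (s t : denom) : dval s * dval t \notin (P : set R).
Proof. case: s t => [s sP] [t tP]; rewrite /dval /=.
by apply/denomP => /prime_idealM[]; apply/denomP. Qed.
Definition denomM (s t : denom) : denom := Sub (dval s * dval t) (denomM_subproof s t).

Lemma val_denom1 : dval denom1 = 1. Proof. by []. Qed.

Lemma val_denomM s t : dval (denomM s t) = dval s * dval t. Proof. by []. Qed.

Let val_denomE := (val_denomM, val_denom1).

Definition loc_eq (x y : R * denom) : bool :=
  `[< exists u : denom, dval u * (x.1 * dval y.2) = dval u * (y.1 * dval x.2) >].

Fact loc_eq_equiv : equiv_class_of loc_eq.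
Proof.
split=> [x|x y|y x z].
- by apply/asboolP; exists denom1.
- by apply/asboolP/asboolP => -[u e]; exists u.
- move=> /asboolP[u e] /asboolP[w f]; apply/asboolP.
  exists (denomM (denomM u w) y.2); rewrite /= !val_denomE.
  transitivity ((dval u * (x.1 * dval y.2)) * (dval w * dval z.2)); first by ring.
  rewrite e.
  transitivity ((dval w * (y.1 * dval z.2)) * (dval u * dval x.2)); first by ring.
  by rewrite f; ring.
Qed.

Canonical loc_eq_rel := EquivRelPack loc_eq_equiv.
Canonical loc_eq_encModRel := defaultEncModRel loc_eq.

(* The localization R_P, with elements the fractions a / s for s outside P. *)
Definition loc := {eq_quot loc_eq}.
HB.instance Definition _ : EqQuotient _ loc_eq loc := EqQuotient.on loc.
HB.instance Definition _ := Choice.on loc.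

Definition lfrac (a : R) (s : denom) : loc := \pi_loc (a, s).

Lemma lfracP a s b t :
  lfrac a s = lfrac b t <-> exists u : denom, dval u * (a * dval t) = dval u * (b * dval s).
Proof.
split=> [/eqP|e]; first by rewrite piE => /asboolP.
by apply/eqP; rewrite piE; apply/asboolP.
Qed.

Lemma lfracE (x : loc) : lfrac (repr x).1 (repr x).2 = x.
Proof. by rewrite /lfrac -surjective_pairing reprK. Qed.

Definition loc_of (a : R) : loc := lfrac a denom1.

Definition loc_add (x y : loc) : loc :=
  let: (a, s) := repr x in let: (b, t) := repr y in
  lfrac (a * dval t + b * dval s) (denomM s t).
Definition loc_opp (x : loc) : loc := let: (a, s) := repr x in lfrac (- a) s.
Definition loc_mul (x y : loc) : loc :=
  let: (a, s) := repr x in let: (b, t) := repr y in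
  lfrac (a * b) (denomM s t).

Lemma lfrac_repr a s : exists2 x, repr (lfrac a s) = x &
  exists u : denom, dval u * (x.1 * dval s) = dval u * (a * dval x.2).
Proof. by exists (repr (lfrac a s)) => //; apply/lfracP; rewrite lfracE. Qed.

Lemma loc_addE a s b t :
  loc_add (lfrac a s) (lfrac b t) = lfrac (a * dval t + b * dval s) (denomM s t).
Proof.
rewrite /loc_add; have [[a' s'] -> [u /= e]] := lfrac_repr a s.
have [[b' t'] -> [v /= f]] := lfrac_repr b t.
apply/lfracP; exists (denomM u v); rewrite /= !val_denomE.
transitivity ((dval u * (a' * dval s)) * dval v * dval t * dval t' +
  (dval v * (b' * dval t)) * dval u * dval s * dval s'); first by ring.
by rewrite e f; ring.
Qed.

Lemma loc_oppE a s : loc_opp (lfrac a s) = lfrac (- a) s.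
Proof.
rewrite /loc_opp; have [[a' s'] -> [u /= e]] := lfrac_repr a s.
by apply/lfracP; exists u; rewrite !mulNr !mulrN e.
Qed.

Lemma loc_mulE a s b t :
  loc_mul (lfrac a s) (lfrac b t) = lfrac (a * b) (denomM s t).
Proof.
rewrite /loc_mul; have [[a' s'] -> [u /= e]] := lfrac_repr a s.
have [[b' t'] -> [v /= f]] := lfrac_repr b t.
apply/lfracP; exists (denomM u v); rewrite /= !val_denomE.
transitivity ((dval u * (a' * dval s)) * (dval v * (b' * dval t))); first by ring.
by rewrite e f; ring.
Qed.

Lemma lfrac_eq a s b t : a * dval t = b * dval s -> lfrac a s = lfrac b t.
Proof. by move=> e; apply/lfracP; exists denom1; rewrite e. Qed.

Fact loc_addA : associative loc_add.
Proof.
move=> x y z; rewrite -(lfracE x) -(lfracE y) -(lfracE z) !loc_addE.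
by apply: lfrac_eq; rewrite /= ?val_denomE; ring.
Qed.

Fact loc_addC : commutative loc_add.
Proof.
move=> x y; rewrite -(lfracE x) -(lfracE y) !loc_addE.
by apply: lfrac_eq; rewrite /= ?val_denomE; ring.
Qed.

Fact loc_add0 : left_id (loc_of 0) loc_add.
Proof.
move=> x; rewrite -(lfracE x) loc_addE.
by apply: lfrac_eq; rewrite /= ?val_denomE; ring.
Qed.

Fact loc_addN : left_inverse (loc_of 0) loc_opp loc_add.
Proof.
move=> x; rewrite -(lfracE x) loc_oppE loc_addE.
by apply: lfrac_eq; rewrite /= ?val_denomE; ring.
Qed.

HB.instance Definition _ :=
  GRing.isZmodule.Build loc loc_addA loc_addC loc_add0 loc_addN.

Fact loc_mulA : associative loc_mul.
Proof.
move=> x y z; rewrite -(lfracE x) -(lfracE y) -(lfracE z) !loc_mulE.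
by apply: lfrac_eq; rewrite /= ?val_denomE; ring.
Qed.

Fact loc_mulC : commutative loc_mul.
Proof.
move=> x y; rewrite -(lfracE x) -(lfracE y) !loc_mulE.
by apply: lfrac_eq; rewrite /= ?val_denomE; ring.
Qed.

Fact loc_mul1 : left_id (loc_of 1) loc_mul.
Proof.
move=> x; rewrite -(lfracE x) loc_mulE.
by apply: lfrac_eq; rewrite /= ?val_denomE; ring.
Qed.

Fact loc_mulDl : left_distributive loc_mul +%R.
Proof.
move=> x y z; rewrite -[RHS]/(loc_add _ _) -[x + y]/(loc_add _ _).
rewrite -(lfracE x) -(lfracE y) -(lfracE z) !(loc_mulE, loc_addE).
by apply: lfrac_eq; rewrite /= ?val_denomE; ring.
Qed.

HB.instance Definition _ := GRing.Zmodule_isComPzRing.Build loc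
  loc_mulA loc_mulC loc_mul1 loc_mulDl.

End Localization.

Section FreeModule.
Context (R : pzRingType) (K : choiceType).

(* The free module R^(K); monalg only provides its module structure over
   nontrivial rings. *)
Definition freemod := {malg R[K]}.

HB.instance Definition _ := GRing.Zmodule.on freemod.

Definition free_gen (k : K) : freemod := << 1 *g k >>.

Definition free_scale (c : R) (g : freemod) : freemod :=
  \sum_(k <- msupp g) (<< c * g@_k *g k >> : {malg R[K]}).

Fact free_scaleE c g k : (free_scale c g)@_k = c * g@_k.
Proof.
rewrite {2}[g]monalgE !raddf_sum mulr_sumr.
by apply/eq_bigr => /= i _; rewrite !mcoeffU mulrnAr.
Qed.

Fact free_scaleA c d g : free_scale c (free_scale d g) = free_scale (c * d) g.
Proof. by apply/malgP=> x; rewrite !free_scaleE mulrA. Qed.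

Fact free_scale1 : left_id 1 free_scale.
Proof. by move=> g; apply/malgP=> k; rewrite !free_scaleE mul1r. Qed.

Fact free_scaleDr : right_distributive free_scale +%R.
Proof.
by move=> c g h; apply/malgP=> k; rewrite !(mcoeffD, free_scaleE) mulrDr.
Qed.

Fact free_scaleDl g : {morph free_scale^~ g : c d / c + d}.
Proof.
by move=> c d; apply/malgP=> k; rewrite !(mcoeffD, free_scaleE) mulrDl.
Qed.

HB.instance Definition _ := GRing.Zmodule_isLmodule.Build R freemod
  free_scaleA free_scale1 free_scaleDr free_scaleDl.

End FreeModule.

Section ExteriorPower.
Context (R : comPzRingType) (M : lmodType R) (n : nat).

Definition upd (m : 'rV[M]_n) (i : 'I_n) (x : M) : 'rV[M]_n :=
  \row_j (if j == i then x else m 0 j).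

Definition multilinear_rel : set (freemod R 'rV[M]_n) :=
  [set z | exists (m : 'rV[M]_n) i (a : R) (x y : M),
     z = free_gen R (upd m i (a *: x + y))
         - (a *: free_gen R (upd m i x) + free_gen R (upd m i y))].

Definition alternating_rel : set (freemod R 'rV[M]_n) :=
  [set z | exists (m : 'rV[M]_n) i j,
     [/\ i != j, m 0 i = m 0 j & z = free_gen R m]].

(* The n-th exterior power; it is R for n = 0 and M for n = 1. *)
Definition extpow : lmodType R :=
  quot_lmod (multilinear_rel `|` alternating_rel).

Definition wedge (m : 'rV[M]_n) : extpow :=
  \pi_(quot_lmod (multilinear_rel `|` alternating_rel)) (free_gen R m).

End ExteriorPower.

Definition fin_gen (R : pzRingType) (V : lmodType R) (N : set V) : Prop :=
  exists k (g : 'I_k -> V), N = span (range g).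

(* Finite presentation of a submodule N of V, as a module in its own right;
   a module M is finitely presented when fin_pres [set: M]. *)
Definition fin_pres (R : pzRingType) (V : lmodType R) (N : set V) : Prop :=
  exists n (f : {linear 'rV[R]_n -> V}),
    range f = N /\ fin_gen [set u | f u = 0].

(* V_n(M) *)
Definition genvec (R : pzRingType) n (M : lmodType R) : set 'rV[M]_n :=
  [set m | span (range (m 0)) = setT].
Arguments genvec {R} n M _.

(* The minimal number of generators when M is finitely generated; 0 is the
   junk value otherwise. *)
Definition mu (R : pzRingType) (M : lmodType R) : nat :=
  xget 0%N [set n | genvec n M !=set0 /\
                    forall k, genvec k M !=set0 -> (n <= k)%N].

Definition det_mod (R : comPzRingType) (M : lmodType R) : lmodType R :=
  extpow M (mu M).

Definition SL (R : comPzRingType) n : set 'M[R]_n := [set A | \det A = 1].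
Arguments SL {R} n _.

Definition rowact (R : pzRingType) (M : lmodType R) n
    (m : 'rV[M]_n) (A : 'M[R]_n) : 'rV[M]_n :=
  \row_j \sum_i A i j *: m 0 i.

Definition SLorbit (R : comPzRingType) (M : lmodType R) n (m : 'rV[M]_n) :
  set 'rV[M]_n := [set rowact m A | A in SL n].

(* The quotient V_n(M) / SL_n(R), as a set of orbits *)
Definition genvec_mod_SL (R : comPzRingType) n (M : lmodType R) :
  set (set 'rV[M]_n) := [set SLorbit m | m in genvec n M].
Arguments genvec_mod_SL {R} n M _.

Section Rings.
Context (R : comPzRingType).

Definition is_unit (x : R) : Prop := exists y, x * y = 1.

Definition divides (d x : R) : Prop := exists c, x = c * d.

Definition invertible_mx n (B : 'M[R]_n) : Prop :=
  exists C : 'M[R]_n, B *m C = 1%:M /\ C *m B = 1%:M.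

Definition elementary_divisor_ring : Prop :=
  forall m n (A : 'M[R]_(m, n)), exists (B : 'M[R]_m) (C : 'M[R]_n),
    let D := B *m A *m C in
    [/\ invertible_mx B, invertible_mx C,
        forall (i : 'I_m) (j : 'I_n), i != j :> nat -> D i j = 0
      & forall (i i' : 'I_m) (j j' : 'I_n), i = j :> nat ->
          i' = i.+1 :> nat -> j' = j.+1 :> nat -> divides (D i' j') (D i j)].

Definition reduced : Prop := forall (x : R) k, x ^+ k = 0 -> x = 0.

Definition fg_ideal (I : set R) : Prop := fin_gen (I : set R^o).

Definition principal_ideal (I : set R) : Prop :=
  exists g, I = ideal_gen [set g].

Definition regular (r : R) : Prop := forall x, r * x = 0 -> x = 0.

Definition mpeval n (p : {mpoly R[n]}) (v : 'I_n -> R) : R :=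
  \sum_(m <- msupp p) p@_m * \prod_(i < n) v i ^+ m i.

Definition local_global : Prop :=
  forall n (p : {mpoly R[n]}), ideal_gen (range (mpeval p)) = setT ->
    exists v, is_unit (mpeval p v).

Definition coherent : Prop :=
  forall I : set R, fg_ideal I -> fin_pres (I : set R^o).

End Rings.

Section Prufer.
Context (R : comPzRingType).

Definition ext_ideal (P : prime_ideal R) (I : set R) : set (loc P) :=
  ideal_gen (@loc_of R P @` I).

Arguments ext_ideal : clear implicits.

Definition arithmetic : Prop := forall I : set R, fg_ideal I ->
  forall P : prime_ideal R, principal_ideal (ext_ideal P I).

Definition prufer : Prop := reduced R /\ arithmetic.

Definition almost_local_global : Prop :=
  forall r : R, regular r -> local_global (quot_ring [set r]).

End Prufer.

(* Main.v *)
Require Import Defs.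
From HB Require Import structures.
From mathcomp Require Import fingroup perm.
From mathcomp Require Import all_boot all_order all_algebra ring.
From mathcomp Require Import boolp classical_sets functions.
From mathcomp Require Import finmap monalg.
Import Defs.

Set Implicit Arguments.
Unset Strict Implicit.
Unset Printing Implicit Defensive.

Import GRing.Theory.
Local Open Scope ring_scope.
Local Open Scope quotient_scope.
Local Open Scope classical_set_scope.

(* Let [m] generate [M], let the columns of [W] generate the relations of [m],
   and let [J] be the ideal of the entries of [W].  The vector [m A] generates
   iff the columns of [A] and [W] together span, the annihilator of the wedge of
   [m] is [J], and [A] may be changed to [A + W Z] without changing [m A].  So the
   theorem says that a spanning pair [(A, W)] with [det A = 1 mod J] can be
   corrected to [det (A + W Z) = 1] (and [J] is the unit ideal when [n > mu],
   since then some [A] with [m A = m] has rank less than [n]), together with a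
   similar statement realizing each unit modulo [J] as a determinant.

   Over an elementary divisor ring, take [W] diagonal and peel off one row at a
   time, the row with the smallest diagonal ideal first.

   In the other case, [R] is locally principal with annihilators generated by
   idempotents, and modulo a regular element each matrix has a vector in its
   column space with the same content.  A maximal ideal among those generated by
   idempotents modulo which the problem has no solution would be prime, so one
   may assume that [R] is a domain.  Then some [W Y] of rank at most one
   has the same content as [W]: if two columns [v], [u] have a nonzero 2x2 minor
   [delta], then [delta] lies in the content of each [v + t u], and modulo [delta]
   some [t] gives the content of both columns together.  Row and column
   operations bring [A] to [diag(1, .., 1, a)] with [a] prime to the last row of
   [W Y], and then [det (A + W Y Z)] is affine in [Z] with the right range. *)

(** * Ideals and contents *)

Section Ideals.
Variable R : comPzRingType.
Implicit Types (I J : set R) (x y : R).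

Definition is_ideal I :=
  [/\ I 0, forall x y, I x -> I y -> I (x + y) & forall a x, I x -> I (a * x)].

Lemma ideal_span (A : set R) : is_ideal (span (A : set R^o)).
Proof.
split=> [|x y|a x]; [exact: span0 | exact: spanD | exact: (spanZ (V := R^o))].
Qed.

Lemma ideal_sum I (T : Type) (s : seq T) (P : pred T) (F : T -> R) :
  is_ideal I -> (forall i, P i -> I (F i)) -> I (\sum_(i <- s | P i) F i).
Proof. by case=> I0 ID _ IF; elim/big_ind: _. Qed.

Lemma idealN I x : is_ideal I -> I x -> I (- x).
Proof. by case=> _ _ IM Ix; rewrite -mulN1r; apply: IM. Qed.

Lemma idealB I x y : is_ideal I -> I x -> I y -> I (x - y).
Proof. by move=> idI Ix Iy; case: (idI) => _ ID _; apply: ID => //; apply: idealN. Qed.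

Lemma span_min I (A : set R) x :
  is_ideal I -> A `<=` I -> span (A : set R^o) x -> I x.
Proof.
move=> idI AI [k [c [v [Av ->]]]]; apply: ideal_sum => // i _.
by case: idI => _ _; apply; apply: AI.
Qed.

Lemma span_ideal I x : is_ideal I -> span (I : set R^o) x -> I x.
Proof. by move=> idI; apply: span_min. Qed.

Lemma idealDr I x y : is_ideal I -> I y -> I (x + y) -> I x.
Proof. by move=> idI Iy Ixy; rewrite -(addrK y x); apply: idealB. Qed.

Lemma ideal_multiples r : is_ideal [set x | exists y, x = r * y].
Proof.
split=> /= [|x y [u ->] [v ->]|a x [u ->]].
- by exists 0; rewrite mulr0.
- by exists (u + v); rewrite mulrDr.
- by exists (a * u); rewrite mulrCA.
Qed.

Lemma ideal_pair a b : is_ideal [set z | exists s t, z = a * s + b * t].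
Proof.
split=> /= [|x y [s [t ->]] [s' [t' ->]]|c x [s [t ->]]].
- by exists 0, 0; rewrite !mulr0 addr0.
- by exists (s + s'), (t + t'); ring.
- by exists (c * s), (c * t); ring.
Qed.

Lemma ideal_mulmx I m n p (N : 'M[R]_(m, n)) (M : 'M_(n, p)) i j :
  is_ideal I -> (forall k, I (N i k)) -> I ((N *m M) i j).
Proof.
move=> idI IN; rewrite mxE; apply: ideal_sum => // k _.
by rewrite mulrC; case: idI => _ _; apply.
Qed.

End Ideals.

Section QuotientMorphism.
Variables (R : comPzRingType) (A : set R).

Fact quot_class_is_zmod_morphism : zmod_morphism (@quot_class R A).
Proof.
move=> x y; apply: (addIr (quot_class A y)).
by rewrite subrK quot_ring_addE subrK.
Qed.

Fact quot_class_is_monoid_morphism : monoid_morphism (@quot_class R A).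
Proof. by split=> // x y; apply: (esym (quot_mulE A x y)). Qed.

HB.instance Definition _ :=
  GRing.isZmodMorphism.Build R (quot_ring A) (@quot_class R A)
    quot_class_is_zmod_morphism.
HB.instance Definition _ :=
  GRing.isMonoidMorphism.Build R (quot_ring A) (@quot_class R A)
    quot_class_is_monoid_morphism.

Lemma quot_class_eq0 x : (quot_class A x = 0) <-> span (A : set R^o) x.
Proof.
rewrite -(rmorph0 (@quot_class R A)); split=> [/eqP|sx].
  by rewrite quot_ringE subr0 => /span_predP.
by apply/eqP; rewrite quot_ringE subr0; apply/span_predP.
Qed.

End QuotientMorphism.

Section QuotientByIdeal.
Variables (R : comPzRingType) (I : set R).
Hypothesis idI : is_ideal I.

Lemma quot_ideal_eq0 x : (quot_class I x = 0) <-> I x.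
Proof.
rewrite quot_class_eq0; split; first exact: span_ideal.
exact: span_inc.
Qed.

Lemma quot_ideal_eq x y : (quot_class I x = quot_class I y) <-> I (x - y).
Proof.
have qB : quot_class I (x - y) = quot_class I x - quot_class I y.
  exact: rmorphB.
rewrite -quot_ideal_eq0 qB; split=> [->|/eqP]; first by rewrite subrr.
by rewrite subr_eq0 => /eqP.
Qed.

(** The two matrices have the same image over the quotient ring by [I], and determinants commute
    with ring morphisms. *)
Lemma det_cong n (X Y : 'M[R]_n) :
  (forall i j, I (X i j - Y i j)) -> I (\det X - \det Y).
Proof.
move=> XY; apply/quot_ideal_eq; rewrite -!det_map_mx; congr (\det _).
by apply/matrixP => i j; rewrite !mxE; apply/quot_ideal_eq.
Qed.

End QuotientByIdeal.

Section Content.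
Variable R : comPzRingType.

(* The traces [\tr (W *m Q)] are the linear combinations of the entries of [W]. *)
Definition content n p (W : 'M[R]_(n, p)) : set R :=
  [set x | exists Q, x = \tr (W *m Q)].

(** A right inverse of the block row formed by [A] and [W]: the columns of the two matrices together
    span the free module. *)
Definition unimodular n p (A : 'M[R]_n) (W : 'M[R]_(n, p)) :=
  exists B C, A *m B + W *m C = 1%:M.

Lemma content_ideal n p (W : 'M[R]_(n, p)) : is_ideal (content W).
Proof.
split=> [|x y [P ->] [Q ->]|a x [P ->]].
- by exists 0; rewrite mulmx0 raddf0.
- by exists (P + Q); rewrite mulmxDr raddfD.
- by exists (a *: P); rewrite -scalemxAr mxtraceZ.
Qed.
Hint Resolve content_ideal : core.

Lemma content_entry n p (W : 'M[R]_(n, p)) i j : content W (W i j).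
Proof.
exists (delta_mx j i); rewrite /mxtrace (bigD1 i) //= big1 => [|k ki].
  rewrite addr0 mxE (bigD1 j) //= big1 ?mxE ?eqxx ?mulr1 ?addr0 // => l lj.
  by rewrite mxE (negPf lj) mulr0.
by rewrite mxE big1 // => l _; rewrite mxE (negPf ki) andbF mulr0.
Qed.

Lemma content_min n p (W : 'M[R]_(n, p)) (I : set R) x :
  is_ideal I -> (forall i j, I (W i j)) -> content W x -> I x.
Proof.
move=> idI IW [Q ->]; apply: ideal_sum => // i _; rewrite mxE.
by apply: ideal_sum => // j _; rewrite mulrC; case: idI => _ _; apply.
Qed.

Lemma content_trans n p n' p' (W : 'M[R]_(n, p)) (W' : 'M[R]_(n', p')) x :
  (forall i j, content W' (W i j)) -> content W x -> content W' x.
Proof. exact: content_min. Qed.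

Lemma content_mul n n' p p' (S : 'M[R]_(n', n)) (W : 'M[R]_(n, p))
    (Y : 'M[R]_(p, p')) x :
  content (S *m W *m Y) x -> content W x.
Proof.
move=> [Q ->]; exists (Y *m Q *m S).
by rewrite -!mulmxA mxtrace_mulC !mulmxA.
Qed.

Lemma content_mull n n' p (S : 'M[R]_(n', n)) (W : 'M[R]_(n, p)) x :
  content (S *m W) x -> content W x.
Proof. by rewrite -[S *m W]mulmx1; apply: content_mul. Qed.

Lemma content_mulr n p p' (W : 'M[R]_(n, p)) (Y : 'M[R]_(p, p')) x :
  content (W *m Y) x -> content W x.
Proof. by have := @content_mul _ _ _ _ 1%:M W Y x; rewrite mul1mx. Qed.

Lemma det_content n p (A : 'M[R]_n) (W : 'M[R]_(n, p)) Z :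
  content W (\det (A + W *m Z) - \det A).
Proof.
apply: det_cong => // i j.
have -> : (A + W *m Z) i j - A i j = (W *m Z) i j by rewrite mxE addrAC subrr add0r.
exact/content_mulr/content_entry.
Qed.

End Content.
#[export] Hint Resolve content_ideal : core.

Section Solvable.
Variable R : comPzRingType.

Definition solvable n p (A : 'M[R]_n) (W : 'M[R]_(n, p)) :=
  exists Z, \det (A + W *m Z) = 1.

Lemma solvable_add n p (A : 'M[R]_n) (W : 'M[R]_(n, p)) Z :
  solvable (A + W *m Z) W -> solvable A W.
Proof. by case=> Z'; rewrite -addrA -mulmxDr => e; exists (Z + Z'). Qed.

Lemma solvable_sub n p q (A : 'M[R]_n) (W : 'M[R]_(n, p)) (Y : 'M_(p, q)) :
  solvable A (W *m Y) -> solvable A W.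
Proof. by case=> Z; rewrite -mulmxA => e; exists (Y *m Z). Qed.

(** Row operations act on both matrices, column operations on [A] alone, and [T'] carries the
    correction back. Only the product of the two determinants has to be 1, so [S] may be any
    invertible matrix if [T] compensates. *)
Lemma solvable_conj n p (A S T T' : 'M[R]_n) (W : 'M[R]_(n, p)) :
  T *m T' = 1%:M -> \det S * \det T = 1 ->
  solvable (S *m A *m T) (S *m W) -> solvable A W.
Proof.
move=> TT' dST [Z e]; exists (Z *m T').
have {e} : \det (S *m (A + W *m (Z *m T')) *m T) = 1.
  rewrite -e; congr (\det _); rewrite mulmxDr mulmxDl !mulmxA.
  by rewrite -[_ *m T' *m T]mulmxA (mulmx1C TT') mulmx1.
by rewrite !det_mulmx mulrAC dST mul1r.
Qed.

Lemma unimodular_add n p (A : 'M[R]_n) (W : 'M[R]_(n, p)) Z :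
  unimodular A W -> unimodular (A + W *m Z) W.
Proof.
case=> B [C e]; exists B, (C - Z *m B).
by rewrite mulmxDl mulmxBr !mulmxA addrACA subrr addr0 in e *.
Qed.

Lemma unimodular_conj n p (A S S' T T' : 'M[R]_n) (W : 'M[R]_(n, p)) :
  S *m S' = 1%:M -> T *m T' = 1%:M ->
  unimodular A W -> unimodular (S *m A *m T) (S *m W).
Proof.
move=> SS' TT' [B [C e]]; exists (T' *m B *m S'), (C *m S').
rewrite -!mulmxA [T *m _]mulmxA TT' mul1mx -mulmxDr.
by rewrite ![_ *m (_ *m S')]mulmxA -mulmxDl e mul1mx.
Qed.

Lemma unimodular_mulr n p q (A : 'M[R]_n) (W : 'M[R]_(n, p)) (Y : 'M_(p, q)) :
  unimodular A (W *m Y) -> unimodular A W.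
Proof. by case=> B [C e]; exists B, (Y *m C); rewrite mulmxA. Qed.

Lemma det_inv n (A B : 'M[R]_n) : A *m B = 1%:M -> \det A * \det B = 1.
Proof. by rewrite -det_mulmx => ->; rewrite det1. Qed.

Lemma mul_adj_det1 n (A : 'M[R]_n) : \det A = 1 -> A *m \adj A = 1%:M.
Proof. by move=> e; rewrite mul_mx_adj e. Qed.

End Solvable.

(** * Elementary divisor rings *)

Section Peeling.
Variable R : comPzRingType.

Lemma lshift_ord0 m : lshift m (0 : 'I_1) = 0 :> 'I_(1 + m).
Proof. exact: val_inj. Qed.

Lemma block_delta_row m (A : 'M[R]_(1 + m)) :
  row 0 A = delta_mx 0 0 -> A = block_mx 1%:M 0 (dlsubmx A) (drsubmx A).
Proof.
move=> A0; rewrite -{1}[A]submxK; congr block_mx; apply/matrixP => i j.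
  have := congr1 (fun M : 'rV_(1 + m) => M 0 (lshift m j)) A0.
  by rewrite !mxE !ord1 !lshift_ord0.
have := congr1 (fun M : 'rV_(1 + m) => M 0 (rshift 1 j)) A0.
by rewrite !mxE !ord1 !lshift_ord0.
Qed.

Lemma mul_low_block m (y : 'cV[R]_m) (A1 : 'M[R]_m) :
  block_mx 1%:M 0 (- y) 1%:M *m block_mx 1%:M 0 y A1 = block_mx 1%:M 0 0 A1.
Proof. by rewrite mulmx_block !mul1mx !mul0mx !mulmx1 !addr0 addNr mulmx0 add0r. Qed.

Lemma mul_low_col m p (y : 'cV[R]_m) (w1 : 'M[R]_(1, p)) (W1 : 'M[R]_(m, p)) :
  block_mx 1%:M 0 (- y) 1%:M *m col_mx w1 W1 = col_mx w1 (W1 - y *m w1).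
Proof. by rewrite mul_block_col !mul1mx mul0mx addr0 mulNmx addrC. Qed.

(** Subtracting [y] times the first row clears the first column of the matrix and turns [W1] into
    [W1 - y *m w1]. A correction with zero first column then keeps the matrix block upper
    triangular, so the determinant is that of the smaller problem. *)
Lemma solvable_peel m p (y : 'cV[R]_m) A1 (w1 : 'M[R]_(1, p)) W1 :
  solvable A1 (W1 - y *m w1) ->
  solvable (block_mx 1%:M 0 y A1) (col_mx w1 W1).
Proof.
move=> [Z e].
apply: (@solvable_conj _ _ _ _ (block_mx 1%:M 0 (- y) 1%:M) 1%:M 1%:M).
- by rewrite mulmx1.
- by rewrite det_lblock !det1 !mulr1.
rewrite mulmx1 mul_low_block mul_low_col; exists (row_mx 0 Z).
rewrite mul_col_row !mulmx0 add_block_mx !addr0 !add0r.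
by rewrite det_ublock det1 mul1r.
Qed.

Lemma unimodular_block m p A1 (w1 : 'M[R]_(1, p)) (W1 : 'M[R]_(m, p)) :
  unimodular (block_mx 1%:M 0 0 A1) (col_mx w1 W1) -> unimodular A1 W1.
Proof.
case=> B [C]; rewrite -[B]submxK -[C]hsubmxK mulmx_block mul_col_row.
rewrite add_block_mx (@scalar_mx_block _ 1 m 1) => /eq_block_mx[_ _ _].
by rewrite mul0mx add0r => e; exists (drsubmx B), (rsubmx C).
Qed.

Lemma unimodular_peel m p (y : 'cV[R]_m) A1 (w1 : 'M[R]_(1, p)) W1 :
  unimodular (block_mx 1%:M 0 y A1) (col_mx w1 W1) ->
  unimodular A1 (W1 - y *m w1).
Proof.
move=> U; apply: (@unimodular_block _ _ _ w1).
rewrite -(mul_low_block y) -mul_low_col -[X in unimodular X _]mulmx1.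
apply: (unimodular_conj (mul_adj_det1 _) (mulmx1 _) U).
by rewrite det_lblock !det1 mulr1.
Qed.

Lemma det_mx22 (M : 'M[R]_2) :
  \det M = M ord0 ord0 * M ord_max ord_max - M ord0 ord_max * M ord_max ord0.
Proof.
rewrite (expand_det_row _ ord0) !big_ord_recl big_ord0 addr0 /cofactor !det_mx11.
rewrite !mxE /= expr0 expr1 mul1r mulN1r mulrN.
by congr (_ * M _ _ - M _ _ * M _ _); apply: val_inj.
Qed.

(** A 2x2 block of determinant 1 built from the Bezout relation sends the first two entries to (1,
    0), and an upper unitriangular matrix clears the remaining entries. *)
Lemma row_pair_reduce m (x : 'rV[R]_(m.+2)) s t :
  x 0 0 * s + x 0 (lift ord0 ord0) * t = 1 ->
  exists T, \det T = 1 /\ x *m T = delta_mx 0 0.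
Proof.
move=> e; pose x' : 'rV_(2 + m) := x.
pose u : 'rV[R]_2 := delta_mx 0 0.
pose a := x' 0 0; pose b := x' 0 (lift ord0 ord0).
pose P : 'M[R]_2 := \matrix_(i, j) if j == 0 then (if i == 0 then s else t)
                                    else (if i == 0 then - b else a).
have PE : lsubmx x' *m P = u.
  apply/rowP => j; rewrite !mxE !big_ord_recl big_ord0 addr0 !mxE /=.
  have -> : lshift m ord0 = 0 :> 'I_(2 + m) by apply: val_inj.
  have -> : lshift m (lift ord0 ord0) = lift ord0 ord0 :> 'I_(2 + m) by apply: val_inj.
  by case: j => -[|[|//]] ? /=; rewrite ?e //; rewrite /a /b; ring.
exists (block_mx P 0 0 1%:M *m block_mx 1%:M (- (u^T *m rsubmx x')) 0 1%:M).
split.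
  rewrite det_mulmx (@det_ublock _ 2 m P) (@det_ublock _ 2 m 1%:M) !det1 !mulr1 det_mx22 !mxE /=.
  by rewrite -[RHS]e /a /b; ring.
rewrite -[x]/x' -[x']hsubmxK mulmxA !(@mul_row_block _ 1 2 m 2 m) PE !mulmx0 !mulmx1 !addr0 add0r.
rewrite mulmxN mulmxA; have -> : u *m u^T = 1%:M.
  by rewrite /u trmx_delta mul_delta_mx; apply/matrixP => i j; rewrite !ord1 !mxE.
rewrite row_mxKr mul1mx addNr; apply/rowP => j; rewrite !mxE.
by case: splitP => k jk; rewrite ?mxE -!val_eqE /= jk.
Qed.

End Peeling.

Section DeterminantProblems.
Variable R : comPzRingType.

(* For a generating vector [m] of a module with relation matrix [W]: if [m A]
   generates and has the same wedge as [m], then [m A = m S] with [det S = 1]. *)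
Definition det_liftable := forall n p (A : 'M[R]_n) (W : 'M[R]_(n, p)),
  unimodular A W -> content W (\det A - 1) -> solvable A W.

(* Same setting: every generator of the determinant is the wedge of some
   generating vector [m A]. *)
Definition det_realizable := forall n p (W : 'M[R]_(n.+1, p)) u u',
  content W (1 - u * u') ->
  exists A, unimodular A W /\ content W (\det A - u).

End DeterminantProblems.

Section ElementaryDivisor.
Variable R : comPzRingType.
Hypothesis edrR : elementary_divisor_ring R.

Lemma edr_hermite m (x : 'rV[R]_(m.+2)) :
  exists T d, \det T = 1 /\ x *m T = d *: delta_mx 0 0.
Proof.
have [B [C [[B' [BB' B'B]] [C' [CC' _]] D0 _]]] := edrR x.
(* Rescaling the second column by the inverse of [\det C] normalizes the determinant; it leaves the
   reduced row unchanged because the second entry of that row is 0. *)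
pose g : 'rV[R]_(m.+2) := \row_j if j == lift ord0 ord0 then \det C' else 1.
exists (C *m diag_mx g), (B' 0 0 * (B *m x *m C) 0 0); split.
  rewrite det_mulmx det_diag (bigD1 (lift ord0 ord0)) //= big1 ?mulr1.
    by rewrite mxE eqxx; apply: det_inv.
  by move=> i /negPf ni; rewrite mxE ni.
have -> : x *m (C *m diag_mx g) = B' *m (B *m x *m C) *m diag_mx g.
  by rewrite !mulmxA B'B mul1mx.
apply/rowP => j; rewrite mul_mx_diag !mxE big_ord1 !mxE.
have [-> |nj] := eqVneq j 0; first by rewrite mulr1.
rewrite [X in _ * X * _](_ : _ = 0) ?mulr0 ?mul0r ?mulr0 //.
have := D0 0 j; rewrite !mxE /=; apply.
by rewrite eq_sym; move: nj; rewrite -val_eqE.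
Qed.

(** Reduce [x] to (d, 0, .., 0). The relation makes [d] and [a] comaximal, so putting [a] in the
    second place yields a row that reduces to (1, 0, .., 0). *)
Lemma edr_row m (x : 'rV[R]_(m.+2)) a (B : 'cV[R]_(m.+2)) c :
  (x *m B) 0 0 + a * c = 1 ->
  exists T z, \det T = 1 /\ (x + a *: z) *m T = delta_mx 0 0.
Proof.
move=> e; have [T [d [dT xT]]] := edr_hermite x.
have TT' := mul_adj_det1 dT.
pose z : 'rV[R]_(m.+2) := delta_mx 0 (lift ord0 ord0) *m \adj T.
have zT : (x + a *: z) *m T = d *: delta_mx 0 0 + a *: delta_mx 0 (lift ord0 ord0).
  by rewrite mulmxDl xT -scalemxAl -mulmxA (mulmx1C TT') mulmx1.
have [|T2 [dT2 e2]] := @row_pair_reduce _ _ ((x + a *: z) *m T) ((\adj T *m B) 0 0) c.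
  rewrite zT !mxE /= !mulr1 !mulr0 addr0 add0r -[RHS]e; congr (_ + _).
  have -> : x *m B = d *: (delta_mx 0 0 *m (\adj T *m B)).
    by rewrite scalemxAl -xT -!mulmxA [T *m _]mulmxA TT' mul1mx.
  by rewrite -rowE !mxE.
exists (T *m T2), z; rewrite det_mulmx dT dT2 mulr1 mulmxA.
by split.
Qed.

(** Later entries divide earlier ones, so the first entry generates the smallest ideal and the last
    one generates the content of the diagonal matrix. *)
Definition division_chain n (a : 'rV[R]_n) :=
  forall i j : 'I_n, (i <= j)%N -> divides (a 0 j) (a 0 i).

Lemma content_diag_chain n (a : 'rV[R]_(n.+1)) x :
  division_chain a -> content (diag_mx a) x -> exists q, x = a 0 ord_max * q.
Proof.
move=> ch; apply: (content_min (ideal_multiples _)) => i j.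
rewrite mxE; case: eqP => _; last by exists 0; rewrite mulr0.
rewrite /= mulr1n; by have [c ->] := ch i ord_max (leq_ord i); exists c; rewrite mulrC.
Qed.

(** The first row is corrected modulo [a 0 0] and then peeled off. This preserves the shape of the
    problem because every later entry of [a] divides [a 0 0], while the last entry, which controls
    the determinant, never changes. *)
Lemma edr_solvable_diag n (a : 'rV[R]_(n.+1)) A :
  division_chain a -> unimodular A (diag_mx a) ->
  (exists q, \det A - 1 = a 0 ord_max * q) -> solvable A (diag_mx a).
Proof.
elim: n a A => [|n IH] a A ch U [q dA].
  exists (- q)%:M; rewrite !det_mx11 !mxE !big_ord1 !mxE in dA *.
  by rewrite -(subrK 1 (A 0 0)) dA !ord1 eqxx !mulr1n; ring.
have [B [C BC]] := U.
have [|T [z [dT e]]] := @edr_row _ (row 0 A) (a 0 0) (col 0 B) (C 0 0).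
  move/matrixP/(_ 0 0): BC; rewrite !mxE eqxx mulr1n => <-; congr (_ + _).
    by apply: eq_bigr => i _; rewrite !mxE.
  rewrite (bigD1 0) //= big1 ?addr0 => [|i ni]; first by rewrite mxE eqxx.
  by rewrite mxE eq_sym (negPf ni) mul0r.
pose Z0 : 'M_(n.+2) := delta_mx 0 (0 : 'I_1) *m z.
have rWZ : row 0 (diag_mx a *m Z0) = a 0 0 *: z.
  apply/rowP => j; rewrite mul_diag_mx !mxE big_ord1 mxE eqxx mul1r.
  by rewrite !ord1.
have rA2 : row 0 ((A + diag_mx a *m Z0) *m T) = delta_mx 0 0.
  by rewrite row_mul raddfD /= rWZ.
have TT' := mul_adj_det1 dT.
apply: (@solvable_add _ _ _ _ _ Z0).
apply: (@solvable_conj _ _ _ _ 1%:M T (\adj T)) => //.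
  by rewrite det1 dT mulr1.
rewrite !mul1mx.
have dA2 : exists q', \det ((A + diag_mx a *m Z0) *m T) - 1 = a 0 ord_max * q'.
  rewrite det_mulmx dT mulr1.
  have [q' e'] := content_diag_chain ch (det_content A (diag_mx a) Z0).
  by exists (q' + q); rewrite mulrDr -e' -dA; ring.
have U2 : unimodular ((A + diag_mx a *m Z0) *m T) (diag_mx a).
  rewrite -[X in X *m T]mul1mx -[X in unimodular _ X]mul1mx.
  exact: (unimodular_conj (mulmx1 1%:M) TT' (unimodular_add _ U)).
move: {U dA e rA2 IH} ((A + _) *m T) (IH) U2 dA2 (block_delta_row rA2) => A2 IH U2 dA2.
set y := dlsubmx _; set A1 := drsubmx _ => EA2; rewrite {}EA2 in U2 dA2 *.
pose a' : 'rV_(1 + n.+1) := a.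
have chr j : divides (rsubmx a' 0 j) (lsubmx a' 0 0).
  by rewrite !mxE; apply: ch.
have Wa : diag_mx a = col_mx (row_mx (diag_mx (lsubmx a')) 0)
                             (row_mx 0 (diag_mx (rsubmx a'))).
  rewrite -block_mxEv; have := diag_mx_row (lsubmx a') (rsubmx a').
  by rewrite hsubmxK.
rewrite Wa in U2 *.
have [c ec] : exists c, row_mx 0 (diag_mx (rsubmx a')) - y *m row_mx (diag_mx (lsubmx a')) 0
             = diag_mx (rsubmx a') *m row_mx c 1%:M.
  have /choice[f fE] := chr.
  exists (- \col_j (f j * y j 0)).
  rewrite !mul_mx_row mulmx0 mulmx1 opp_row_mx add_row_mx add0r oppr0 addr0.
  congr row_mx; rewrite mulmxN; congr (- _); apply/colP => j.
  rewrite mul_diag_mx !mxE big_ord1 !mxE !ord1 eqxx mulr1n.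
  by have := fE j; rewrite !mxE => ->; ring.
apply: solvable_peel; rewrite ec.
apply: (@solvable_sub _ _ (1 + n.+1) n.+1 _ _ (col_mx 0 1%:M)).
rewrite -mulmxA mul_row_col mulmx0 add0r !mulmx1.
have mE : rsubmx a' 0 ord_max = a 0 ord_max.
  by rewrite mxE; congr (a _ _); apply: val_inj.
apply: IH.
- move=> i j ij; rewrite !mxE; apply: ch.
  by rewrite /= leq_add2l.
- by move/unimodular_peel: U2; rewrite ec; apply: unimodular_mulr.
by rewrite mE; rewrite (@det_lblock _ 1 n.+1) det1 mul1r in dA2.
Qed.

(** Diagonal form with a square diagonal matrix: the [n] zero columns appended to [W] ensure that
    each row has a diagonal entry, and the rectangular identity [J] extracts the square part. Since
    [W] and the diagonal form are multiples of one another on the right, up to [B], they pose the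
    same problems. *)
Lemma edr_smith n p (W : 'M[R]_(n, p)) :
  exists (B B' : 'M[R]_n) a (Y : 'M_(p, n)) Y', [/\ B *m B' = 1%:M, division_chain a,
    B *m W *m Y = diag_mx a & B *m W = diag_mx a *m Y'].
Proof.
have [B [C [[B' [BB' _]] [C' [CC' _]] D0 Dd]]] := edrR (row_mx W (0 : 'M_(n, n))).
set D := B *m _ *m C in D0 Dd; have eD : B *m row_mx W 0 *m C = D by [].
clearbody D.
pose J : 'M[R]_(p + n, n) := \matrix_(i, j) (i == j :> nat)%:R.
have jP (j : 'I_n) : (j < p + n)%N by rewrite ltn_addl.
pose w j := Ordinal (jP j).
pose a : 'rV_n := \row_j D j (w j).
have DJ : D *m J = diag_mx a.
  apply/matrixP => i j; rewrite !mxE (bigD1 (w j)) //= big1 ?addr0.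
    rewrite mxE eqxx mulr1; case: eqP => [->|ne] //.
    by apply: D0 => /=; apply/eqP => /val_inj.
  move=> k nk; rewrite mxE; case: eqP => [ek|]; last by rewrite mulr0.
  by case/eqP: nk; apply: val_inj.
have JD : diag_mx a *m J^T = D.
  apply/matrixP => i j; rewrite mul_diag_mx !mxE.
  case: eqP => [e|ne]; last by rewrite mulr0 D0 //; apply/eqP => /esym.
  by rewrite mulr1; congr (D _ _); apply: val_inj.
exists B, B', a, (row_mx 1%:M 0 *m C *m J), (J^T *m C' *m col_mx 1%:M 0); split=> //.
- suff H k (i j : 'I_n) : val j = (i + k)%N -> divides (a 0 j) (a 0 i).
    by move=> i j ij; apply: (H (j - i)%N); rewrite subnKC.
  elim: k j => [|k IH] j jk.
    have -> : i = j by apply: val_inj; rewrite /= jk addn0.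
    by exists 1; rewrite mul1r.
  have kn : (i + k < n)%N by apply: ltn_trans (ltn_ord j); rewrite [X in (_ < X)%N]jk addnS.
  have [c ->] := IH (Ordinal kn) erefl.
  have [|||d] := Dd (Ordinal kn) j (w (Ordinal kn)) (w j) => //=.
  - by rewrite jk addnS.
  - by rewrite jk addnS.
  by move=> e; exists (c * d); rewrite !mxE e mulrA.
- rewrite -DJ -eD !mulmxA; congr (_ *m _ *m _); rewrite -mulmxA; congr (_ *m _).
  by rewrite mul_mx_row mulmx1 mulmx0.
rewrite !mulmxA JD -eD -[_ *m C *m C']mulmxA CC' mulmx1 -mulmxA; congr (_ *m _).
by rewrite mul_row_col mulmx1 mulmx0 addr0.
Qed.

Lemma edr_det_liftable : det_liftable R.
Proof.
move=> [|n] p A W U dA; first by exists 0; rewrite det_mx00.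
have [B [B' [a [Y [Y' [BB' ch BWY BW]]]]]] := edr_smith W.
have dBB' := det_inv BB'.
apply: (solvable_conj (mulmx1C BB') dBB'); apply: (@solvable_sub _ _ _ _ _ _ Y).
rewrite BWY; apply: edr_solvable_diag => //.
  by apply: (@unimodular_mulr _ _ _ _ _ _ Y'); rewrite -BW;
     apply: unimodular_conj BB' (mulmx1C BB') U.
apply: content_diag_chain => //.
rewrite !det_mulmx mulrAC dBB' mul1r; apply: (@content_mulr _ _ _ _ _ Y').
rewrite -BW; apply: (@content_mull _ _ _ _ B').
by rewrite mulmxA (mulmx1C BB') mul1mx.
Qed.

Lemma edr_det_realizable : det_realizable R.
Proof.
move=> n p W u u' cu.
have [B [B' [a [Y [Y' [BB' ch BWY BW]]]]]] := edr_smith W.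
have [x ex] : exists x, 1 - u * u' = a 0 ord_max * x.
  apply: content_diag_chain => //; apply: (@content_mulr _ _ _ _ _ Y').
  rewrite -BW; apply: (@content_mull _ _ _ _ B').
  by rewrite mulmxA (mulmx1C BB') mul1mx.
(* In diagonal coordinates take diag(1, .., 1, u). Its last entry is invertible modulo the last
   entry of [a], with inverse [u'], and the other entries are 1. *)
pose d (c e : R) : 'rV_n.+1 := \row_i if i == ord_max then c else e.
exists (B' *m diag_mx (d u 1) *m B); split.
  apply: (@unimodular_mulr _ _ _ _ _ _ Y).
  have -> : W *m Y = B' *m diag_mx a.
    by rewrite -BWY !mulmxA (mulmx1C BB') mul1mx.
  apply: unimodular_conj (mulmx1C BB') BB' _.
  exists (diag_mx (d u' 1)), (diag_mx (d x 0)).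
  apply/matrixP => i j; rewrite !mul_diag_mx !mxE.
  case: (i =P ord_max) => [->|_]; last by rewrite mul0rn mulr0 addr0 mul1r.
  case: (ord_max =P j) => _; last by rewrite !mulr0 addr0.
  by rewrite !mulr1n -ex; ring.
rewrite !det_mulmx mulrAC (det_inv (mulmx1C BB')) mul1r det_diag big_ord_recr /=.
rewrite big1 ?mul1r => [|i _].
  by rewrite mxE eqxx subrr; case: (content_ideal W).
by rewrite mxE -val_eqE /= ltn_eqF.
Qed.

End ElementaryDivisor.

(** * Domains *)

Section Reduction.
Variable R : comPzRingType.

(* Modulo [r], the column space of [V] contains a vector with the same content
   as [V], with a prescribed coefficient equal to 1. *)
Definition content_attained (r : R) :=
  forall n p (V : 'M[R]_(n, p)) (j0 : 'I_p), exists t : 'cV[R]_p,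
    t j0 0 = 1 /\ forall i j, exists z, content (V *m t) (V i j - r * z).

Definition last_diag n (a : R) : 'M[R]_n.+1 :=
  diag_mx (\row_i if i == ord_max then a else 1).

(** The normal form sought for [A], after a correction by [W] and row and column operations of total
    determinant 1. The vector [w] follows the row operations and must end with a last entry
    comaximal to [a]. *)
Definition last_diag_reducible n p (A : 'M[R]_n.+1) (W : 'M[R]_(n.+1, p))
    (w : 'cV[R]_n.+1) :=
  exists Z S S' T T' a b c, [/\ S *m S' = 1%:M, T *m T' = 1%:M,
    \det S * \det T = 1, S *m (A + W *m Z) *m T = last_diag n a
    & a * b + (S *m w) ord_max 0 * c = 1].

Lemma reducible_add n p (A : 'M[R]_n.+1) (W : 'M[R]_(n.+1, p)) w Z0 :
  last_diag_reducible (A + W *m Z0) W w -> last_diag_reducible A W w.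
Proof.
case=> Z [S [S' [T [T' [a [b [c [? ? ?]]]]]]]]; rewrite -addrA -mulmxDr => ? ?.
by exists (Z0 + Z), S, S', T, T', a, b, c.
Qed.

Lemma reducible_conj n p (A : 'M[R]_n.+1) (W : 'M[R]_(n.+1, p)) w S0 S0' T0 T0' :
  S0 *m S0' = 1%:M -> T0 *m T0' = 1%:M -> \det S0 * \det T0 = 1 ->
  last_diag_reducible (S0 *m A *m T0) (S0 *m W) (S0 *m w) ->
  last_diag_reducible A W w.
Proof.
move=> SS TT dST [Z [S [S' [T [T' [a [b [c [SS' TT' dST' e e']]]]]]]]].
exists (Z *m T0'), (S *m S0), (S0' *m S'), (T0 *m T), (T' *m T0'), a, b, c.
split=> //.
- by rewrite mulmxA -[S *m _ *m _]mulmxA SS mulmx1.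
- by rewrite mulmxA -[T0 *m _ *m _]mulmxA TT' mulmx1.
- rewrite !det_mulmx; transitivity (\det S0 * \det T0 * (\det S * \det T)).
    by ring.
  by rewrite dST dST' mulr1.
- rewrite -e; rewrite !mulmxDr !mulmxDl !mulmxA; congr (_ + _ *m _).
  by rewrite -[_ *m T0' *m T0]mulmxA (mulmx1C TT) mulmx1.
by rewrite -mulmxA.
Qed.

Lemma reducible_block n p (A : 'M[R]_n.+1) (W : 'M[R]_(n.+1, p)) w
    (w1 : 'M[R]_(1, p)) (x : 'M[R]_1) :
  last_diag_reducible A W w ->
  @last_diag_reducible n.+1 p (block_mx (1%:M : 'M_1) 0 0 A) (col_mx w1 W) (col_mx x w).
Proof.
move=> [Z [S [S' [T [T' [a [b [c [SS' TT' dST e e']]]]]]]]].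
exists (row_mx (0 : 'cV_p) Z), (block_mx (1%:M : 'M_1) 0 0 S), (block_mx (1%:M : 'M_1) 0 0 S').
(* The correction [Z] also creates the entries [w1 *m Z] in the first row; the upper right block of
   the column operation cancels them. *)
exists (block_mx (1%:M : 'M_1) (- (w1 *m Z *m T)) 0 T), (block_mx (1%:M : 'M_1) (w1 *m Z) 0 T').
exists a, b, c; split.
- rewrite (@mulmx_block _ 1 n.+1 1 n.+1 1 n.+1).
  by rewrite !mulmx0 !mul0mx !addr0 !add0r mul1mx SS' -scalar_mx_block.
- rewrite (@mulmx_block _ 1 n.+1 1 n.+1 1 n.+1).
  rewrite !mulmx0 !mul0mx !addr0 !add0r !mul1mx mulNmx -!mulmxA TT' mulmx1 subrr.
  by rewrite -scalar_mx_block.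
- by rewrite (@det_ublock _ 1 n.+1 1%:M) (@det_ublock _ 1 n.+1 1%:M) !det1 !mul1r.
- rewrite (@mul_col_row _ 1 n.+1 p 1 n.+1) !mulmx0.
  rewrite (@add_block_mx _ 1 n.+1 1 n.+1) !addr0 !add0r.
  rewrite !(@mulmx_block _ 1 n.+1 1 n.+1 1 n.+1).
  rewrite !mulmx0 !mul0mx !addr0 !add0r !mul1mx mulmx1 addNr e.
  apply/matrixP => i j; rewrite /last_diag [RHS]mxE.
  rewrite -[i]/(i : 'I_(1 + n.+1)) -[j]/(j : 'I_(1 + n.+1)).
  rewrite [LHS]mxE; case: (@splitP 1 n.+1 i) => i' ii; rewrite [LHS]mxE;
  case: (@splitP 1 n.+1 j) => j' jj; rewrite !mxE -!val_eqE /= ii jj ?ord1 //=.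
  by rewrite big_ord1 mxE mul0r add0r !add1n !eqSS.
rewrite (@mul_block_col _ 1 n.+1 1 n.+1) !mul1mx !mul0mx addr0 add0r.
have -> : ord_max = rshift 1 ord_max :> 'I_n.+2 by apply: val_inj.
by rewrite (@col_mxEd _ 1 n.+1).
Qed.

(** All 2x2 minors vanish, which expresses rank at most one without division. *)
Definition minors0 n p (N : 'M[R]_(n, p)) :=
  forall i k j l, N i j * N k l = N i l * N k j.

Lemma minors0_mull n m p (S : 'M[R]_(m, n)) (W : 'M[R]_(n, p)) :
  minors0 W -> minors0 (S *m W).
Proof.
move=> mW i k j l; rewrite !mxE !big_distrlr /=; apply: eq_bigr => a _.
by apply: eq_bigr => b _; rewrite mulrACA mW mulrACA.
Qed.

Lemma minors0_mulr n m p (W : 'M[R]_(n, p)) (Y : 'M[R]_(p, m)) :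
  minors0 W -> minors0 (W *m Y).
Proof.
move=> mW i k j l; rewrite !mxE !big_distrlr /= exchange_big /=.
by apply: eq_bigr => b _; apply: eq_bigr => a _; rewrite mulrACA mW; ring.
Qed.

Lemma minors0_col n (w : 'cV[R]_n) : minors0 w.
Proof. by move=> i k j l; rewrite !ord1. Qed.

(** Matrix determinant lemma: the bordered matrix [M] is evaluated by two block eliminations. The
    factor [v] on the left stands in for a division by [v]. *)
Lemma det_scalar_rank1 n (v : R) (c : 'cV[R]_n) (d : 'rV[R]_n) :
  v * \det (v%:M + c *m d) = v ^+ n * (v + (d *m c) 0 0).
Proof.
pose M : 'M_(1 + n) := block_mx 1%:M (- d) c v%:M.
have d1 : \det M = \det (v%:M + c *m d).
  have := det_mulmx (block_mx 1%:M 0 (- c) 1%:M : 'M_(1 + n)) M.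
  rewrite det_lblock !det1 !mul1r => <-.
  rewrite mulmx_block !mul1mx !mul0mx !addr0 mulmx1 addNr mulNmx mulmxN opprK.
  by rewrite det_ublock det1 mul1r addrC.
have := det_mulmx M (block_mx v%:M 0 (- c) 1%:M).
rewrite mulmx_block !mulmx0 !mulmx1 !add0r mulmxN mulNmx opprK mul1mx.
rewrite scalar_mxC mulmxN subrr det_ublock det_lblock det1 d1 mulr1 !det_scalar.
rewrite det_mx11 !mxE eqxx mulr1n expr1 => e.
by rewrite mulrC -e mulrC.
Qed.

End Reduction.

Section Domain.
Variable D : comPzRingType.
Hypothesis dom : forall x y : D, x * y = 0 -> x = 0 \/ y = 0.
Hypothesis D1 : (1 : D) <> 0.
Hypothesis att : forall r : D, r <> 0 -> content_attained r.

Lemma dom_mul (x y : D) : x <> 0 -> y <> 0 -> x * y <> 0.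
Proof. by move=> x0 y0 /dom[]. Qed.

Lemma dom_cancel (x y z : D) : x <> 0 -> x * y = x * z -> y = z.
Proof.
move=> x0 /eqP; rewrite -subr_eq0 -mulrBr => /eqP/dom[//|/eqP].
by rewrite subr_eq0 => /eqP.
Qed.

Lemma dom_expf (x : D) n : x <> 0 -> x ^+ n <> 0.
Proof. by move=> x0; elim: n => [|n IH] //; rewrite exprS; apply: dom_mul. Qed.

Lemma mx_neq0 n p (M : 'M[D]_(n, p)) : M <> 0 -> exists i j, M i j <> 0.
Proof.
move=> M0; apply: contrapT => H; apply: M0; apply/matrixP => i j; rewrite mxE.
by apply: contrapT => nz; apply: H; exists i, j.
Qed.

(** For a nonzero entry [v], the matrix [v *: N] is a column times a row; the rank-one formula
    applies and powers of [v] cancel in the domain. *)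
Lemma det1_minors0 n (N : 'M[D]_n) : minors0 N -> \det (1%:M + N) = 1 + \tr N.
Proof.
move=> mN; have [->|/eqP/mx_neq0[i0 [j0 v0]]] := eqVneq N 0.
  by rewrite addr0 det1 raddf0 addr0.
set v := N i0 j0 in v0.
have cd : col j0 N *m row i0 N = v *: N.
  by apply/matrixP => i j; rewrite !mxE big_ord1 !mxE mN mulrC.
have dc : (row i0 N *m col j0 N) 0 0 = v * \tr N.
  rewrite !mxE /mxtrace mulr_sumr; apply: eq_bigr => i _.
  by rewrite !mxE mN.
apply: (@dom_cancel (v * v ^+ n)); first exact/dom_mul/dom_expf.
have := det_scalar_rank1 v (col j0 N) (row i0 N).
have -> : v%:M + col j0 N *m row i0 N = v *: (1%:M + N).
  by rewrite cd scalerDr scalemx1.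
by rewrite dc detZ mulrA => ->; ring.
Qed.

(** Linearity in the last row: it is the last row of [1%:M + N] plus [a - 1] times the last unit
    vector. Both resulting determinants are given by the trace formula. *)
Lemma det_last_diag_minors0 n a (N : 'M[D]_n.+1) : minors0 N ->
  \det (last_diag n a + N) = a + (a - 1) * (\tr N - N ord_max ord_max) + \tr N.
Proof.
move=> mN.
pose N0 : 'M_n.+1 := \matrix_(i, j) if i == ord_max then 0 else N i j.
have mN0 : minors0 N0.
  move=> i k j l; rewrite !mxE; case: eqP => _; case: eqP => _;
  by rewrite ?mul0r ?mulr0.
have tN0 : \tr N0 = \tr N - N ord_max ord_max.
  rewrite /mxtrace [in RHS]big_ord_recr /= addrK big_ord_recr /= mxE eqxx addr0.
  by apply: eq_bigr => i _; rewrite mxE -val_eqE /= ltn_eqF.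
have lF i : (lift ord_max i == ord_max :> 'I_n.+1) = false.
  by rewrite eq_sym; apply: negPf (neq_lift _ _).
rewrite (@determinant_multilinear _ _ _ (1%:M + N) (1%:M + N0) ord_max 1 (a - 1)).
- by rewrite !det1_minors0 // tN0; ring.
- apply/rowP => j; rewrite !mxE eqxx; case: eqP => _; rewrite ?mulr1n ?mulr0n; ring.
- by apply/matrixP => i j; rewrite !mxE lF.
- by apply/matrixP => i j; rewrite !mxE lF.
Qed.

Lemma solvable_last_diag n q a b (W : 'M[D]_(n.+1, q)) (y : 'cV_q) :
  minors0 W -> a * b + (W *m y) ord_max 0 = 1 -> content W (1 - a) ->
  solvable (last_diag n a) W.
Proof.
move=> mW e [Q eQ].
(* Scaling every column of [Q] but the last by [b] turns the off-last trace [s] into [b * s]. Adding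
   [s] times [y] to the last column then makes all terms in [s] cancel, since [a * b] and the last
   entry of [W *m y] sum to 1. *)
pose s := \tr (W *m Q) - (W *m Q) ord_max ord_max.
pose Z : 'M_(q, n.+1) := \matrix_(k, j)
  if j == ord_max then Q k j + s * y k 0 else b * Q k j.
exists Z; rewrite det_last_diag_minors0; last exact: minors0_mulr.
have ZE i j : (W *m Z) i j = if j == ord_max then (W *m Q) i j + s * (W *m y) i 0
                             else b * (W *m Q) i j.
  rewrite !mxE; case: ifP => jm; rewrite !mulr_sumr -?big_split /=;
  by apply: eq_bigr => k _; rewrite mxE jm; ring.
have eZ : \tr (W *m Z) - (W *m Z) ord_max ord_max = b * s.
  rewrite /s /mxtrace ![in LHS]big_ord_recr /= addrK [in RHS]big_ord_recr /= addrK.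
  by rewrite mulr_sumr; apply: eq_bigr => i _; rewrite ZE -val_eqE /= ltn_eqF.
rewrite eZ -(subrK ((W *m Z) ord_max ord_max) (\tr (W *m Z))) eZ ZE eqxx.
have -> : (W *m Q) ord_max ord_max = 1 - a - s by rewrite eQ /s opprB addrC subrK.
have -> : (W *m y) ord_max 0 = 1 - a * b by rewrite -e addrC addKr.
ring.
Qed.

(** Induction on the columns: the columns after the first are replaced by a rank-one matrix [U] of
    the same content. If the first column spoils rank one, all columns are merged into a single one,
    using content attainment modulo a nonzero minor. *)
Lemma rank_one_content n p (W : 'M[D]_(n, p)) :
  exists q (Y : 'M_(p, q)), minors0 (W *m Y) /\ forall i j, content (W *m Y) (W i j).
Proof.
elim: p W => [|p IH] W.
  exists 0%N, 0; split=> [i k []//|i []//].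
pose W' : 'M_(n, 1 + p) := W.
have [q [Y]] := IH (rsubmx W'); set U := _ *m Y => -[mU cU].
have eU : U = rsubmx W' *m Y by [].
clearbody U.
pose V := row_mx (lsubmx W') U.
have WV : W' *m block_mx 1%:M 0 0 Y = V.
  by rewrite -[W']hsubmxK mul_row_block !mulmx0 mulmx1 addr0 add0r /V eU.
have cVW (M : set D) : is_ideal M -> (forall i j, M (V i j)) -> forall i j, M (W' i j).
  move=> idM MV i j; rewrite -(hsubmxK W') mxE; case: splitP => k _.
    by have := MV i (lshift q k); rewrite row_mxEl.
  apply: (content_min idM _ (cU i k)) => i' j'.
  by have := MV i' (rshift 1 j'); rewrite row_mxEr.
have [mV|] := pselect (minors0 V).
  exists (1 + q)%N, (block_mx (1%:M : 'M_1) 0 0 Y); rewrite WV; split=> // i j.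
  by apply: cVW => // i' j'; apply: content_entry.
move=> nmV.
have [i [k [j dl]]] : exists i k j,
    lsubmx W' i 0 * U k j - U i j * lsubmx W' k 0 <> 0.
  apply: contrapT => H; apply: nmV => i k j l.
  have vU i' k' j' : lsubmx W' i' 0 * U k' j' = U i' j' * lsubmx W' k' 0.
    apply: subr0_eq; apply: contrapT => nz.
    by apply: H; exists i', k', j'.
  rewrite /V ![row_mx _ _ _ _]mxE.
  by case: splitP => j' _; case: splitP => l' _; rewrite ?ord1 ?vU // mU.
set dlt := _ - _ in dl.
(* The coefficient of the first column is prescribed to be 1, so that the combination still has
   [dlt] as a minor with a column of [U]. *)
have [t [t0 ct]] := att dl V (lshift q 0).
pose w := V *m t.
have wE i' : w i' 0 = lsubmx W' i' 0 + (U *m dsubmx (t : 'cV_(1 + q))) i' 0.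
  rewrite /w -[t in LHS](@vsubmxK _ 1 q) mul_row_col mxE; congr (_ + _).
  by rewrite mxE big_ord1 [usubmx _ _ _]mxE t0 mulr1.
(* The contribution of [U] to the minor of [w] and column [j] of [U] vanishes because [U] has rank
   one; what remains is [dlt]. *)
have cw : content w dlt.
  have -> : dlt = w i 0 * U k j - w k 0 * U i j.
    rewrite !wE /dlt.
    suff: (U *m dsubmx (t : 'cV_(1 + q))) i 0 * U k j =
          (U *m dsubmx (t : 'cV_(1 + q))) k 0 * U i j.
      by move=> e; rewrite !mulrDl e; ring.
    rewrite !mxE !mulr_suml; apply: eq_bigr => l _.
    by rewrite mulrAC mU; ring.
  apply: idealB => //; rewrite mulrC; case: (content_ideal w) => _ _; apply;
  exact: content_entry.
exists 1%N, (block_mx (1%:M : 'M_1) 0 0 Y *m t); rewrite mulmxA WV; split.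
  exact: minors0_col.
move=> i' j'; apply: cVW => // {}i' {}j'.
have [z cz] := ct i' j'; rewrite -(subrK (dlt * z) (V i' j')).
case: (content_ideal w) => _ cD cM; apply: cD => //.
by rewrite mulrC; apply: cM.
Qed.

(** First make the leading entry a nonzero [y], then, modulo [y], let the second entry attain the
    content of the other entries together with [w]. The first two entries now generate the unit
    ideal. *)
Lemma row_reduce n p (x : 'rV[D]_n.+2) (w : 'rV[D]_p) (B : 'cV_n.+2) (C : 'cV_p) :
  (x *m B) 0 0 + (w *m C) 0 0 = 1 ->
  exists (Z : 'M_(p, n.+2)) T, \det T = 1 /\ (x + w *m Z) *m T = delta_mx 0 0.
Proof.
pose x' : 'rV_(1 + n.+1) := x.
have xE : x = row_mx (lsubmx x') (rsubmx x') by rewrite hsubmxK.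
move=> e.
(* If every such combination vanished, then [x] and [w] would be zero, against [e] and [D1]. *)
have [t0 [s0 nz0]] : exists t s,
    (lsubmx x' + rsubmx x' *m t + w *m s) 0 0 <> 0.
  apply: contrapT => H; apply: D1; rewrite -e.
  have H' t s : (lsubmx x' + rsubmx x' *m t + w *m s) 0 0 = 0.
    by apply: contrapT => nz; apply: H; exists t, s.
  have x1 : lsubmx x' = 0.
    by have := H' 0 0; rewrite !mulmx0 !addr0 => x0; apply/matrixP => i j;
       rewrite !ord1 x0 mxE.
  have x2 : rsubmx x' = 0.
    apply/rowP => j; have := H' (delta_mx j 0) 0.
    by rewrite mulmx0 addr0 x1 add0r -colE !mxE.
  have w0 : w = 0.
    apply/rowP => j; have := H' 0 (delta_mx j 0).
    by rewrite mulmx0 addr0 x1 add0r -colE !mxE.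
  by rewrite xE x1 x2 w0 row_mx0 !mul0mx mxE addr0.
set y := _ + _ in nz0.
pose V := row_mx (rsubmx x') w.
have [t [t1 ct]] := att nz0 V (lshift p 0).
(* A unipotent matrix with first column [tl] exists because the leading coefficient of [t] is 1; it
   places [V *m t] in the second entry of the row. *)
pose tl : 'cV_(1 + n) := usubmx t; pose P := block_mx 1%:M 0 (dsubmx tl) 1%:M.
have Pt : P *m delta_mx 0 0 = tl.
  rewrite -[RHS]vsubmxK -colE; apply/colP => j; rewrite mxE /P.
  rewrite [LHS]mxE [RHS]mxE; case: splitP => j' _; rewrite mxE;
  case: splitP => k; rewrite ?ord1 //= => _; rewrite ?mxE ?ord1 //.
  by rewrite eqxx mulr1n -t1; congr (t _ _); apply: val_inj.
pose T1 : 'M_(1 + n.+1) := block_mx 1%:M 0 t0 1%:M.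
pose T2 : 'M_(1 + n.+1) := block_mx 1%:M 0 0 P.
have dP : \det P = 1 by rewrite det_lblock !det1 mulr1.
have dT1 : \det T1 = 1 by rewrite det_lblock !det1 mulr1.
have dT2 : \det T2 = 1 by rewrite det_lblock dP det1 mulr1.
pose Z1 : 'M_(p, 1 + n.+1) := row_mx s0 0.
pose e0 : 'rV[D]_n.+1 := delta_mx 0 0.
pose Z2 : 'M_(p, 1 + n.+1) := row_mx 0 (dsubmx t *m e0).
pose v := (rsubmx x' + w *m (dsubmx t *m e0)) *m P.
have rE : (x + w *m (Z1 + Z2 *m \adj T1)) *m (T1 *m T2) = row_mx y v.
  rewrite mulmxA.
  have -> : (x + w *m (Z1 + Z2 *m \adj T1)) *m T1 = (x + w *m Z1) *m T1 + w *m Z2.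
    rewrite mulmxDr addrA [LHS]mulmxDl; congr (_ + _).
    by rewrite -!mulmxA (mulmx1C (mul_adj_det1 dT1)) mulmx1.
  have -> : (x + w *m Z1) *m T1 = row_mx y (rsubmx x').
    rewrite xE mul_mx_row mulmx0 (@add_row_mx _ 1 1 n.+1) addr0 (@mul_row_block _ 1 1 n.+1 1 n.+1) !mulmx1 !mulmx0 add0r.
    by rewrite /y addrAC.
  rewrite mul_mx_row mulmx0 (@add_row_mx _ 1 1 n.+1) addr0.
  by rewrite (@mul_row_block _ 1 1 n.+1 1 n.+1) !mulmx1 !mulmx0 addr0 add0r.
have v0 : v 0 0 = (V *m t) 0 0.
  have -> : v 0 0 = (v *m delta_mx 0 (0 : 'I_1)) 0 0 by rewrite -colE [RHS]mxE.
  rewrite /v -mulmxA Pt mulmxDl -[t in RHS]vsubmxK mul_row_col.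
  congr ((_ + _ : 'M_1) 0 0).
  rewrite -!mulmxA; congr (_ *m _).
  have -> : e0 *m tl = 1%:M.
    rewrite /e0 -rowE; apply/matrixP => i j; rewrite !ord1 !mxE eqxx -t1.
    by congr (t _ _); apply: val_inj.
  by rewrite mulmx1.
(* The ideal of the first two entries; it will be shown to contain all entries of [x] and [w], hence
   1. *)
pose J : set D := [set z | exists s u : D, z = y 0 0 * s + v 0 0 * u].
have idJ : is_ideal J by apply: ideal_pair.
have [_ JD _] := idJ.
have VJ j : J (V 0 j).
  have [z cz] := ct 0 j; rewrite -(subrK (y 0 0 * z) (V 0 j)); apply: JD.
    apply: (content_min idJ _ cz) => i k; rewrite !ord1.
    by exists 0, 1; rewrite v0 mulr0 add0r mulr1.
  by exists z, 0; rewrite mulr0 addr0.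
have xJ j : J (rsubmx x' 0 j) by have := VJ (lshift p j); rewrite row_mxEl.
have wJ j : J (w 0 j) by have := VJ (rshift n.+1 j); rewrite row_mxEr.
have yJ : J (lsubmx x' 0 0).
  have -> : lsubmx x' 0 0 = y 0 0 - ((rsubmx x' *m t0) 0 0 + (w *m s0) 0 0).
    by rewrite /y !mxE; ring.
  apply: (idealB idJ); first by exists 1, 0; rewrite mulr1 mulr0 addr0.
  by apply: JD; apply: ideal_mulmx.
have [s [u e1]] : J 1.
  rewrite -e; apply: (JD); apply: ideal_mulmx => // j.
  rewrite xE mxE.
  by case: (@splitP 1 n.+1 j) => k _; rewrite ?ord1.
have [|T [dT eT]] := @row_pair_reduce D n (row_mx y v) s u.
  rewrite e1; congr (_ * _ + _ * _).
    by rewrite -[RHS](row_mxEl y v); congr (row_mx _ _ _ _); apply: val_inj.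
  by rewrite -[RHS](row_mxEr y v); congr (row_mx _ _ _ _); apply: val_inj.
exists (Z1 + Z2 *m \adj T1), (T1 *m T2 *m T).
by rewrite !det_mulmx dT1 dT2 dT !mulr1 mulmxA rE.
Qed.

(* When the part of [w] below the first row vanishes, adding another column of
   [A] to the first one and clearing the first column again makes it nonzero. *)
Lemma domain_reducible n p (A : 'M[D]_n.+1) (W : 'M[D]_(n.+1, p)) w :
  unimodular A W -> w <> 0 -> last_diag_reducible A W w.
Proof.
elim: n => [|n IH] in A W w * => U w0.
  have r0 : w 0 0 <> 0.
    by move=> e; apply: w0; apply/matrixP => i j; rewrite !ord1 e mxE.
  (* In size one, correct [A] with its own coefficient kept equal to 1: together with [w], the
     result [a] generates the content of the row of [A] and [W], which is the unit ideal. *)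
  have [t [t0 ct]] := att r0 (row_mx A W) (lshift p 0).
  pose a := (A + W *m dsubmx (t : 'cV_(1 + p))) 0 0.
  have aE : row_mx A W *m t = A + W *m dsubmx (t : 'cV_(1 + p)).
    rewrite -[t in LHS](@vsubmxK _ 1 p) mul_row_col; congr (_ + _).
    have -> : usubmx (t : 'cV_(1 + p)) = 1%:M; last by rewrite mulmx1.
    apply/matrixP => i j; rewrite !ord1 !mxE eqxx mulr1n -t0.
    by congr (t _ _); apply: val_inj.
  have idJ := ideal_pair a (w 0 0); set J := [set z | _] in idJ.
  have VJ j : J (row_mx A W 0 j).
    have [z cz] := ct 0 j; rewrite -(subrK (w 0 0 * z) (row_mx A W 0 j)).
    have [_ JD _] := idJ; apply: JD; last by exists 0, z; rewrite mulr0 add0r.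
    apply: (content_min idJ _ cz) => i k; rewrite !ord1 aE.
    by exists 1, 0; rewrite mulr0 mulr1 addr0.
  have [B [C /matrixP/(_ 0 0) BC]] := U.
  have [b [c e]] : J 1.
    have -> : 1 = (A *m B + W *m C) 0 0 by rewrite BC mxE eqxx.
    rewrite [X in J X]mxE; have [_ JD _] := idJ; apply: (JD); apply: ideal_mulmx => // k.
      by rewrite !ord1; have := VJ (lshift p 0); rewrite row_mxEl.
    by have := VJ (rshift 1 k); rewrite row_mxEr.
  exists (dsubmx (t : 'cV_(1 + p))), 1%:M, 1%:M, 1%:M, 1%:M, a, b, c.
  rewrite !mulmx1 !mul1mx det1 mulr1; split=> //.
    apply/matrixP => i j; rewrite !ord1 [RHS]mxE eqxx mulr1n.
    by rewrite [RHS]mxE -val_eqE.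
  by rewrite e; congr (_ + w _ _ * _); apply: val_inj.
have key A1 (w1 : 'M_(1, p)) W1 (x : 'M_1) : unimodular A1 W1 -> A1 <> 0 -> x <> 0 ->
    @last_diag_reducible D n.+1 p (block_mx (1%:M : 'M_1) 0 0 A1)
      (col_mx w1 W1) (col_mx x 0).
  move=> U1 /mx_neq0[i [j a0]] x0.
  pose y := col j A1.
  have Ty : block_mx (1%:M : 'M_1) 0 (delta_mx j 0) 1%:M *m
            block_mx (1%:M : 'M_1) 0 (- delta_mx j 0) 1%:M = 1%:M :> 'M[D]_(1 + n.+1).
    rewrite mulmx_block !mulmx1 !mulmx0 !mul0mx !mul1mx !addr0 add0r subrr.
    by rewrite -scalar_mx_block.
  have Sy : block_mx (1%:M : 'M_1) 0 (- y) 1%:M *m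
            block_mx (1%:M : 'M_1) 0 y 1%:M = 1%:M :> 'M[D]_(1 + n.+1).
    by rewrite mul_low_block -scalar_mx_block.
  apply: (reducible_conj Sy Ty).
    by rewrite !(@det_lblock _ 1 n.+1) !det1 !mulr1.
  have -> : block_mx (1%:M : 'M_1) 0 (- y) 1%:M *m block_mx (1%:M : 'M_1) 0 0 A1 *m
       block_mx (1%:M : 'M_1) 0 (delta_mx j 0) 1%:M = block_mx (1%:M : 'M_1) 0 0 A1.
    rewrite -mulmxA [X in _ *m X]mulmx_block !mulmx1 !mulmx0 !mul0mx !addr0 !add0r.
    by rewrite -colE mul_low_block.
  rewrite !mul_low_col; apply: reducible_block; apply: IH.
    have [B [C BC]] := U1; exists (B + delta_mx j 0 *m w1 *m C), C.
    by rewrite mulmxDr mulmxBl -BC /y colE !mulmxA addrACA subrr addr0.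
  rewrite sub0r => /matrixP/(_ i 0); rewrite !mxE big_ord1 !mxE => /eqP.
  rewrite oppr_eq0 => /eqP; apply: dom_mul => // xx.
  by apply: x0; apply/matrixP => k l; rewrite !ord1 xx mxE.
have main A1 (w1 : 'M_(1, p)) W1 (x : 'M_1) w' : unimodular A1 W1 -> col_mx x w' <> 0 ->
    @last_diag_reducible D n.+1 p (block_mx (1%:M : 'M_1) 0 0 A1)
      (col_mx w1 W1) (col_mx x w').
  move=> U1 xw0; have [w'0|/eqP w'0] := eqVneq w' 0; last first.
    by apply: reducible_block; apply: IH.
  have x0 : x <> 0 by move=> x0; apply: xw0; rewrite x0 w'0 col_mx0.
  rewrite w'0; have [A0|/eqP A0] := eqVneq A1 0; last exact: key.
  (* Here [A1] is zero, so unimodularity forces [W1] to be nonzero, and a correction by one of its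
     columns reduces to the case of a nonzero [A1]. *)
  have [i [j W0]] : exists i j, W1 i j <> 0.
    apply: mx_neq0 => W0; have [B [C /matrixP/(_ 0 0)]] := U1.
    by rewrite A0 W0 !mul0mx addr0 !mxE eqxx => /esym.
  pose Z : 'M[D]_(p, n.+1) := delta_mx j (0 : 'I_1) *m delta_mx 0 0.
  have TT : block_mx (1%:M : 'M_1) (- (w1 *m Z)) 0 1%:M *m
            block_mx (1%:M : 'M_1) (w1 *m Z) 0 1%:M = 1%:M :> 'M[D]_(1 + n.+1).
    rewrite mulmx_block !mulmx1 !mulmx0 !mul0mx !mul1mx !addr0 !add0r subrr.
    by rewrite -scalar_mx_block.
  apply: (reducible_add (Z0 := row_mx (0 : 'cV_p) Z)).
  apply: (reducible_conj (mulmx1 1%:M) TT).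
    by rewrite (@det_ublock _ 1 n.+1) !det1 !mulr1.
  rewrite !mul1mx A0 (@mul_col_row _ 1 n.+1 p 1 n.+1) !mulmx0.
  rewrite (@add_block_mx _ 1 n.+1 1 n.+1) !addr0 !add0r.
  rewrite (@mulmx_block _ 1 n.+1 1 n.+1 1 n.+1) !mulmx0 !mul0mx !mulmx1 mul1mx.
  rewrite !addr0 !add0r addNr; apply: key => //.
    by have := unimodular_add Z U1; rewrite A0 add0r.
  move=> /matrixP/(_ i 0); rewrite mulmxA -colE mxE big_ord1 !mxE eqxx mulr1.
  exact: W0.
have [B [C /matrixP/(_ 0 0) BC]] := U.
have [|Z [T [dT eT]]] := @row_reduce n p (row 0 A) (row 0 W) (col 0 B) (col 0 C).
  move: BC; rewrite !mxE eqxx mulr1n => <-.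
  by congr (_ + _); apply: eq_bigr => i _; rewrite !mxE.
have TT' := mul_adj_det1 dT.
apply: (reducible_add (Z0 := Z)); apply: (reducible_conj (mulmx1 1%:M) TT').
  by rewrite det1 dT mulr1.
rewrite !mul1mx.
have rA2 : row 0 ((A + W *m Z) *m T) = delta_mx 0 0.
  by rewrite row_mul raddfD /= row_mul.
have U2 : unimodular ((A + W *m Z) *m T) W.
  rewrite -[X in X *m T]mul1mx -[X in unimodular _ X]mul1mx.
  exact: (unimodular_conj (mulmx1 1%:M) TT' (unimodular_add _ U)).
move: {U rA2} (_ *m T) U2 (block_delta_row rA2) => A2 U2.
set y := dlsubmx _; set A1 := drsubmx _ => EA2; rewrite {}EA2 in U2 *.
have Sy : block_mx (1%:M : 'M_1) 0 (- y) 1%:M *m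
          block_mx (1%:M : 'M_1) 0 y 1%:M = 1%:M :> 'M[D]_(1 + n.+1).
  by rewrite mul_low_block -scalar_mx_block.
apply: (reducible_conj Sy (mulmx1 1%:M)).
  by rewrite (@det_lblock _ 1 n.+1) !det1 !mulr1.
rewrite -[W](@vsubmxK _ 1 n.+1) -[w](@vsubmxK _ 1 n.+1) in U2 w0 *.
rewrite mulmx1 mul_low_block !mul_low_col; apply: main.
  exact: unimodular_peel U2.
move=> e; apply: w0; rewrite -mul_low_col in e.
rewrite -[LHS]mul1mx -(mulmx1C Sy) -mulmxA.
by rewrite e mulmx0.
Qed.

Lemma domain_det_liftable : det_liftable D.
Proof.
move=> [|n] p A W U dA; first by exists 0; rewrite det_mx00.
have [W0|/eqP W0] := eqVneq W 0.
  exists 0; rewrite mulmx0 addr0; apply: subr0_eq.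
  by have [Q ->] := dA; rewrite W0 mul0mx raddf0.
have [q [Y [mY cY]]] := rank_one_content W.
(* A nonzero column of the rank-one matrix serves as the vector [w] in the reduction to diag(1, ..,
   1, a). *)
have [i [j y0]] : exists i j, (W *m Y) i j <> 0.
  apply: mx_neq0 => e; apply: W0; apply/matrixP => i j.
  by have [Q ->] := cY i j; rewrite e mul0mx raddf0 mxE.
have [|Z [S [S' [T [T' [a [b [c [SS' TT' dST e e']]]]]]]]] :=
    @domain_reducible n p A W (col j (W *m Y)) U.
  by move=> /matrixP/(_ i 0); rewrite !mxE => e; apply: y0; rewrite mxE.
apply: (@solvable_add _ _ _ _ _ Z); apply: (@solvable_sub _ _ _ _ _ _ Y).
apply: (solvable_conj TT' dST); rewrite e.
apply: (@solvable_last_diag _ _ _ b _ (c *: delta_mx j 0)).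
- exact: minors0_mull.
- by rewrite -[RHS]e' -scalemxAr mxE [c * _]mulrC !colE !mulmxA.
(* The operations have total determinant 1, so [a] is the corrected determinant and remains
   congruent to 1 modulo the content. *)
have aE : a = \det (A + W *m Z).
  have := congr1 determinant e; rewrite !det_mulmx mulrAC dST mul1r => ->.
  rewrite det_diag big_ord_recr /= big1 ?mul1r ?mxE ?eqxx // => k _.
  by rewrite mxE -val_eqE /= ltn_eqF.
apply: (@content_mull _ _ _ _ S'); rewrite mulmxA (mulmx1C SS') mul1mx.
apply: content_trans cY _.
rewrite aE -opprB; apply: idealN => //.
rewrite -(subrK (\det A) (\det (A + _))) -addrA; case: (content_ideal W) => _ ID _.
by apply: ID => //; apply: det_content.
Qed.

End Domain.

(** * Locally principal rings *)

Section IdealZorn.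
Variable R : comPzRingType.

(** Zorn's lemma with a starting point: each set is united with [I0], so the empty chain is covered
    by [I0] itself and only nonempty chains need checking. *)
Lemma maximal_above (T : Type) (P : set (set T)) (I0 : set T) :
  P I0 ->
  (forall F : set (set T), F !=set0 -> F `<=` P -> total_on F subset ->
     P (\bigcup_(X in F) X)) ->
  exists I, P I /\ forall J, I `<=` J -> P J -> J `<=` I.
Proof.
move=> P0 Pchain.
have [F FP Ftot|A [PA maxA]] := @Zorn_bigcup T [set X | P (X `|` I0)].
  have [->|/set0P[X0 FX0]] := eqVneq F set0; first by rewrite /= bigcup_set0 set0U.
  rewrite /=; have -> : (\bigcup_(X in F) X) `|` I0 = \bigcup_(X in [set Y `|` I0 | Y in F]) X.
    apply/seteqP; split=> x.
      case=> [[X FX Xx]|Ix].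
        by exists (X `|` I0); [exists X | left].
      by exists (X0 `|` I0); [exists X0 | right].
    by case=> _ [X FX <-] [Xx|Ix]; [left; exists X | right].
  apply: Pchain => [|_ [X FX <-]|_ _ [X FX <-] [Y FY <-]].
  - by exists (X0 `|` I0), X0.
  - exact: FP.
  - by have [XY|YX] := Ftot X Y FX FY; [left|right]; apply: setSU.
exists (A `|` I0); split=> // J AJ PJ.
have [JA|nJA] := pselect (J `<=` A); first by move=> x /JA; left.
exfalso; apply: (maxA J).
  by split=> [x Ax|/nJA//]; apply: AJ; left.
by rewrite /= setUidl // => x Ix; apply: AJ; right.
Qed.

Lemma ideal_chain (F : set (set R)) : F !=set0 -> total_on F subset ->
  (forall X, F X -> is_ideal X) -> is_ideal (\bigcup_(X in F) X).
Proof.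
move=> [X0 FX0] Ftot Fid; split.
- by exists X0 => //; case: (Fid _ FX0).
- move=> x y [X FX Xx] [Y FY Yy].
  have [XY|YX] := Ftot X Y FX FY.
    by exists Y => //; case: (Fid _ FY) => _ ID _; apply: ID => //; apply: XY.
  by exists X => //; case: (Fid _ FX) => _ ID _; apply: ID => //; apply: YX.
by move=> a x [X FX Xx]; exists X => //; case: (Fid _ FX) => _ _; apply.
Qed.

Definition ideal_adjoin (I : set R) (x : R) : set R :=
  [set z | exists i a, I i /\ z = i + a * x].

Lemma ideal_adjoin_ideal I x : is_ideal I -> is_ideal (ideal_adjoin I x).
Proof.
case=> I0 ID IM; split=> [|_ _ [i [a [Ii ->]]] [j [b [Ij ->]]]|c _ [i [a [Ii ->]]]].
- by exists 0, 0; split=> //; rewrite mul0r addr0.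
- by exists (i + j), (a + b); split; [apply: ID | ring].
- by exists (c * i), (c * a); split; [apply: IM | ring].
Qed.

Lemma sub_ideal_adjoin I x : I `<=` ideal_adjoin I x.
Proof. by move=> i Ii; exists i, 0; rewrite mul0r addr0. Qed.

Lemma mem_ideal_adjoin I x : is_ideal I -> ideal_adjoin I x x.
Proof. by case=> I0 _ _; exists 0, 1; rewrite mul1r add0r. Qed.

Lemma prime_above (I0 : set R) : is_ideal I0 -> ~ I0 1 ->
  exists P : prime_ideal R, I0 `<=` P.
Proof.
move=> id0 n1.
have [||I [[idI I1 I0I] maxI]] := @maximal_above R
    [set I | [/\ is_ideal I, ~ I 1 & I0 `<=` I]] I0; first by split.
  move=> F F0 FP Ftot; split.
  - by apply: ideal_chain => // X /FP[].
  - by case=> X /FP[].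
  - by case: F0 => X FX x x0; exists X => //; case: (FP _ FX) => _ _; apply.
have [IZ ID IM] := idI.
have prI x y : I (x * y) -> I x \/ I y.
  move=> Ixy; have [Ix|nIx] := pselect (I x); [by left | right].
  have [i [a [Ii e]]] : ideal_adjoin I x 1.
    apply: contrapT => n; apply: nIx.
    apply: (maxI (ideal_adjoin I x)); first exact: sub_ideal_adjoin.
    split=> //; first exact: ideal_adjoin_ideal.
      exact: subset_trans I0I (@sub_ideal_adjoin _ _).
    exact: mem_ideal_adjoin.
  have -> : y = y * i + a * (x * y) by rewrite -[LHS]mulr1 e; ring.
  by apply: ID; apply: IM.
by exists (PrimeIdeal IZ ID IM I1 prI).
Qed.

End IdealZorn.

Section Arithmetic.
Variable R : comPzRingType.

Section LocalRing.
Variable P : prime_ideal R.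

Lemma loc_ofD x y : loc_of P (x + y) = loc_of P x + loc_of P y.
Proof. by rewrite [RHS]loc_addE; apply: lfrac_eq; rewrite /= ?val_denomM ?val_denom1; ring. Qed.

Lemma loc_ofM x y : loc_of P (x * y) = loc_of P x * loc_of P y.
Proof. by rewrite [RHS]loc_mulE; apply: lfrac_eq; rewrite /= ?val_denomM ?val_denom1; ring. Qed.

(** The maximal ideal of the local ring at [P]. *)
Definition loc_max : set (loc P) := [set z | exists n s, prime_set P n /\ z = lfrac n s].

Lemma loc_max_ideal : is_ideal loc_max.
Proof.
split=> [|_ _ [n [s [Pn ->]]] [m [t [Pm ->]]]|z _ [n [s [Pn ->]]]].
- by exists 0, (denom1 P); split=> //; apply: prime_ideal0.
- rewrite [_ + _]loc_addE; exists (n * dval t + m * dval s), (denomM s t); split=> //.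
  by apply: prime_idealD; rewrite mulrC; apply: prime_idealMl.
rewrite -(lfracE z) [_ * _]loc_mulE; exists ((repr z).1 * n), (denomM (repr z).2 s).
by split=> //; apply: prime_idealMl.
Qed.

Lemma dvalP (s : denom P) : ~ prime_set P (dval s).
Proof. by apply/denomP/(valP s). Qed.

Lemma loc_max1 : ~ loc_max 1.
Proof.
move=> [n [s [Pn /lfracP[u]]]]; rewrite !val_denom1 mul1r mulr1 => e.
have : prime_set P (dval u * dval s) by rewrite e; apply: prime_idealMl.
by case/prime_idealM; apply: dvalP.
Qed.

Lemma loc_unit z : ~ loc_max z -> exists z', z * z' = 1.
Proof.
move=> nz; have nP : ~ prime_set P (repr z).1.
  by move=> Pz; apply: nz; exists (repr z).1, (repr z).2; rewrite lfracE.
have nP' : (repr z).1 \notin (P : set R) by apply/denomP.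
pose s : denom P := exist (fun s => is_true (s \notin (P : set R))) _ nP'.
exists (lfrac (dval (repr z).2) s).
rewrite -{1}(lfracE z) [_ * _]loc_mulE.
by apply: lfrac_eq; rewrite val_denomM val_denom1 mulr1 mul1r mulrC.
Qed.

Lemma loc_of_eq0 a : loc_of P a = 0 -> exists u : R, ~ prime_set P u /\ u * a = 0.
Proof.
move=> /lfracP[u]; rewrite !val_denom1 !mulr1 mulr0 => e.
by exists (dval u); split=> //; apply: dvalP.
Qed.

Lemma loc_of_multiple a b z : loc_of P b = z * loc_of P a ->
  exists u v : R, ~ prime_set P u /\ u * b = v * a.
Proof.
rewrite -(lfracE z) [_ * _]loc_mulE => /lfracP[u].
rewrite val_denomM !val_denom1 !mulr1 => e.
exists (dval u * dval (repr z).2), (dval u * (repr z).1); split.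
  by case/prime_idealM; apply: dvalP.
by rewrite -mulrA [_ * b]mulrC e mulrA.
Qed.

End LocalRing.

(** Of two elements, one divides the other locally at each prime. The sums of multipliers witnessing
    this form an ideal [N] that lies in no prime, so it contains 1. *)
Lemma arithmetic_comaximal : arithmetic R ->
  forall a b : R, exists s u v, s * a = u * b /\ (1 - s) * b = v * a.
Proof.
move=> arR a b.
pose N : set R := [set z | exists s t u v, [/\ z = s + t, s * a = u * b & t * b = v * a]].
have idN : is_ideal N.
  split=> [|_ _ [s [t [u [v [-> e f]]]]] [s' [t' [u' [v' [-> e' f']]]]]|
           c _ [s [t [u [v [-> e f]]]]]].
  - by exists 0, 0, 0, 0; rewrite addr0 !mul0r.
  - exists (s + s'), (t + t'), (u + u'), (v + v').
    by split; [ring | rewrite !mulrDl e e' | rewrite !mulrDl f f'].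
  - exists (c * s), (c * t), (c * u), (c * v).
    by split; [ring | rewrite -!mulrA e | rewrite -!mulrA f].
have [[s [t [u [v [e1 e f]]]]]|n1] := pselect (N 1).
  by exists s, u, v; split=> //; rewrite e1 addrC addKr.
have [P NP] := prime_above idN n1.
have NPs s u : ~ prime_set P s -> s * a = u * b -> False.
  by move=> Ps e; apply/Ps/NP; exists s, 0, u, 0; rewrite addr0 !mul0r.
have NPt t v : ~ prime_set P t -> t * b = v * a -> False.
  by move=> Pt e; apply/Pt/NP; exists 0, t, 0, v; rewrite add0r !mul0r.
pose h (i : 'I_2) : R^o := if i == 0 then a else b.
pose I : set R := span (range h).
have [|g eg] := arR I _ P; first by exists 2%N, h.
have Ia : I a by apply: span_inc; exists 0.
have Ib : I b by apply: span_inc; exists 1.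
have gz z : ideal_gen [set g] z -> exists w, z = w * g.
  move=> [k [c [v [vg ->]]]].
  exists (\sum_(i < k) c i); rewrite mulr_suml; apply: eq_bigr => i _.
  by rewrite (vg i).
have Iab x : I x -> exists p q : R, x = a * p + b * q.
  apply: (span_min (ideal_pair a b)) => _ [i _ <-]; rewrite /h.
  by case: ifP => _; [exists 1, 0 | exists 0, 1]; rewrite mulr1 mulr0 ?addr0 ?add0r.
have [x [y gxy]] : exists x y, g = loc_of P a * x + loc_of P b * y.
  have : ideal_gen [set g] g by apply: span_inc.
  rewrite -eg; apply: (span_min (ideal_pair _ _)) => _ [z /Iab[p [q ->]] <-].
  by exists (loc_of P p), (loc_of P q); rewrite loc_ofD !loc_ofM.
have [al ea] : exists w, loc_of P a = w * g.
  by apply: gz; rewrite -eg; apply: span_inc; exists a.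
have [be eb] : exists w, loc_of P b = w * g.
  by apply: gz; rewrite -eg; apply: span_inc; exists b.
exfalso.
have [mal|/loc_unit[al' eal]] := pselect (loc_max al); last first.
  have [|u [v [Pu e]]] := @loc_of_multiple P a b (be * al'); last exact: NPt Pu e.
  rewrite ea; transitivity (be * (al * al') * g); last by ring.
  by rewrite eal mulr1.
have [mbe|/loc_unit[be' ebe]] := pselect (loc_max be); last first.
  have [|u [v [Pu e]]] := @loc_of_multiple P b a (al * be'); last exact: NPs Pu e.
  rewrite eb; transitivity (al * (be * be') * g); last by ring.
  by rewrite ebe mulr1.
have [lM0 lMD lMM] := loc_max_ideal P.
(* Nakayama's argument: if both cofactors of the local generator [g] lie in the maximal ideal, then
   [g] is zero, and so are [a] and [b] locally. *)
have [z ez] : exists z, (1 - (al * x + be * y)) * z = 1.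
  apply: loc_unit => m1; apply: (@loc_max1 P).
  rewrite -(subrK (al * x + be * y) 1); apply: (lMD) => //.
  by apply: (lMD); rewrite mulrC; apply: (lMM).
have g0 : g = 0.
  rewrite -[g]mul1r -ez; transitivity (z * (g - (al * g * x + be * g * y))).
    by ring.
  by rewrite -ea -eb -gxy subrr mulr0.
have [u [Pu ua]] : exists u : R, ~ prime_set P u /\ u * a = 0.
  by apply: loc_of_eq0; rewrite ea g0 mulr0.
by apply: (NPs u 0) => //; rewrite mul0r.
Qed.

End Arithmetic.

(** * Local-global rings *)

Section TraceOne.
Variable R : comPzRingType.
Hypothesis comax : forall a b : R, exists s u v, s * a = u * b /\ (1 - s) * b = v * a.

(* [Q] plays the role of [g^-1 g] for a generating family [g] of a locally
   principal ideal. *)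
Lemma trace_one_mx k (g : 'rV[R]_k.+1) : exists Q : 'M[R]_k.+1,
  \tr Q = 1 /\ forall a b c, Q a b * g 0 c = Q a c * g 0 b.
Proof.
elim: k g => [|k IH] g.
  exists 1%:M; split=> [|a b c]; first by rewrite mxtrace1.
  by rewrite !ord1.
pose g' : 'rV_(1 + k.+1) := g.
pose a0 := g' 0 (lshift k.+1 0).
have [q [q1 qs]] := IH (rsubmx g').
have /choice[s hs] : forall i, exists s, exists u v,
    s * a0 = u * rsubmx g' 0 i /\ (1 - s) * rsubmx g' 0 i = v * a0.
  by move=> i; have [s [u [v H]]] := comax a0 (rsubmx g' 0 i); exists s, u, v.
have /choice[u hu] := hs; have /choice[v huv] := hu.
have {hs hu} su i := (huv i).1; have {huv} sv i := (huv i).2.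
(* The diagonal weight [q i i] is split by [s i]: one part stays at the entry [i], the part
   [1 - s i] moves to the new entry, so the trace is still 1. *)
pose Q : 'M_(1 + k.+1) := block_mx
  (\sum_i q i i * (1 - s i))%:M (\row_j \sum_i q i j * v i)
  (\col_i (u i * q i i)) (\matrix_(i, j) (s i * q i j)).
exists Q; split.
  rewrite (@mxtrace_block _ 1 k.+1) /mxtrace big_ord1 !mxE eqxx mulr1n -big_split -[RHS]q1 /=.
  by apply: eq_bigr => i _; rewrite !mxE; ring.
have gE0 : g' 0 (lshift k.+1 0) = a0 by [].
have gE1 j : g' 0 (rshift 1 j) = rsubmx g' 0 j by rewrite mxE.
have Q00 : Q (lshift k.+1 0) (lshift k.+1 0) = \sum_i q i i * (1 - s i).
  by rewrite block_mxEul mxE eqxx mulr1n.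
have Q01 j : Q (lshift k.+1 0) (rshift 1 j) = \sum_i q i j * v i.
  by rewrite block_mxEur mxE.
have Q10 i : Q (rshift 1 i) (lshift k.+1 0) = u i * q i i.
  by rewrite block_mxEdl mxE.
have Q11 i j : Q (rshift 1 i) (rshift 1 j) = s i * q i j.
  by rewrite block_mxEdr mxE.
have H01 a j : Q a (lshift k.+1 0) * rsubmx g' 0 j = Q a (rshift 1 j) * a0.
  rewrite -[a](@splitK 1 k.+1); case: fintype.split => i /=; rewrite ?ord1.
    rewrite Q00 Q01 !mulr_suml; apply: eq_bigr => i' _.
    rewrite -[RHS]mulrA -sv.
    transitivity ((1 - s i') * (q i' i' * rsubmx g' 0 j)); first by ring.
    by rewrite qs; ring.
  rewrite Q10 Q11 -mulrA qs; transitivity (q i j * (s i * a0)); last by ring.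
  by rewrite su; ring.
move=> a b c; rewrite -[g]/g'.
rewrite -[b](@splitK 1 k.+1) -[c](@splitK 1 k.+1).
case: (@fintype.split 1 k.+1 b) => j; case: (@fintype.split 1 k.+1 c) => l;
  rewrite /= ?ord1 ?gE0 ?gE1 ?H01 //.
rewrite -[a](@splitK 1 k.+1); case: fintype.split => i /=; rewrite ?ord1.
  rewrite !Q01 !mulr_suml; apply: eq_bigr => i' _.
  by rewrite mulrAC qs mulrAC.
by rewrite !Q11 -!mulrA qs.
Qed.

Lemma trace_one_family (K : finType) (k0 : K) (g : K -> R) : exists Q : K -> K -> R,
  \sum_k Q k k = 1 /\ forall a b c, Q a b * g c = Q a c * g b.
Proof.
have : (0 < #|K|)%N by apply/card_gt0P; exists k0.
case e : #|K| => [//|n] _.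
pose f (i : 'I_n.+1) : K := enum_val (cast_ord (esym e) i).
pose r (k : K) : 'I_n.+1 := cast_ord e (enum_rank k).
have rK : cancel r f by move=> k; rewrite /f /r cast_ordK enum_rankK.
have fK : cancel f r by move=> i; rewrite /f /r enum_valK cast_ordKV.
have [Q [Q1 Qs]] := trace_one_mx (\row_i g (f i)).
exists (fun a b => Q (r a) (r b)); split.
  rewrite -Q1 /mxtrace (reindex r) //=.
  by exists f => ? _.
by move=> a b c; have := Qs (r a) (r b) (r c); rewrite !mxE !rK.
Qed.

End TraceOne.

Section LocalGlobal.
Variable R : comPzRingType.

Lemma mpevalE n (d : {fset cmonom 'I_n}) (p : {mpoly R[n]}) v :
  (msupp p `<=` d)%fset ->
  mpeval p v = \sum_(m <- d) p@_m * \prod_(i < n) v i ^+ m i.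
Proof.
move=> pd; rewrite /mpeval (big_fset_incl _ pd) // => m _ mp.
by rewrite mcoeff_outdom // mul0r.
Qed.

Lemma mpevalD n (p q : {mpoly R[n]}) v : mpeval (p + q) v = mpeval p v + mpeval q v.
Proof.
rewrite (mpevalE v (msuppD_le p q)) (mpevalE v (fsubsetUl (msupp p) (msupp q))).
rewrite (mpevalE v (fsubsetUr (msupp p) (msupp q))) -big_split /=.
by apply: eq_bigr => m _; rewrite mcoeffD mulrDl.
Qed.

Lemma mpevalU n c (m : cmonom 'I_n) v :
  mpeval (<< c *g m >> : {mpoly R[n]}) v = c * \prod_(i < n) v i ^+ m i.
Proof. by rewrite (mpevalE v (msuppU_le)) big_seq_fset1 mcoeffU eqxx. Qed.

Lemma mpeval_sum n (I : finType) (F : I -> {mpoly R[n]}) v :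
  mpeval (\sum_i F i) v = \sum_i mpeval (F i) v.
Proof.
elim/big_ind2: _ => [|p x q y <- <-|//]; last exact: mpevalD.
by rewrite /mpeval msupp0 big_seq_fset0.
Qed.

Lemma prod_ucm n (i0 : 'I_n) (v : 'I_n -> R) : \prod_(i < n) v i ^+ (ucm i0 : cmonom 'I_n) i = v i0.
Proof.
rewrite (bigD1 i0) //= cmU eqxx expr1 big1 ?mulr1 // => i ni.
by rewrite cmU eq_sym (negPf ni).
Qed.

Hypothesis lgR : local_global R.

(** The values of the form generate every coefficient: unit vectors [y] with [t] zero off [j0] give
    the [q i j0], and one further nonzero coordinate of [t] gives the others by subtraction. Hence
    some value is a unit, whose inverse is absorbed in [y]. *)
Lemma bilinear_represents_one (I J : finType) (q : I -> J -> R) (j0 : J) c :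
  \sum_i \sum_j c i j * q i j = 1 ->
  exists t y, t j0 = 1 /\ \sum_i \sum_j q i j * t j * y i = 1.
Proof.
move=> cq.
pose N := (#|I| + #|J|)%N.
pose iy (i : I) : 'I_N := lshift _ (enum_rank i).
pose it (j : J) : 'I_N := rshift _ (enum_rank j).
(* The polynomial is the sum of the [q i j * t j * y i], with [t j0] set to 1. *)
pose m i j : cmonom 'I_N := if j == j0 then (ucm (iy i)) else mmul (ucm (iy i)) (ucm (it j)).
pose p : {mpoly R[N]} := \sum_i \sum_j << q i j *g m i j >>.
have pE v : mpeval p v =
    \sum_i \sum_j q i j * (if j == j0 then 1 else v (it j)) * v (iy i).
  rewrite /p mpeval_sum; apply: eq_bigr => i _; rewrite mpeval_sum.
  apply: eq_bigr => j _; rewrite mpevalU -mulrA; congr (_ * _).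
  rewrite /m; case: eqP => _; first by rewrite mul1r prod_ucm.
  rewrite -[in RHS](prod_ucm (it j)) -[in RHS](prod_ucm (iy i)) -big_split /=.
  by apply: eq_bigr => k _; rewrite cmM exprD mulrC.
pose vv (t : J -> R) (y : I -> R) (k : 'I_N) := match fintype.split k with
  inl a => y (enum_val a) | inr b => t (enum_val b) end.
have vvy t y i : vv t y (iy i) = y i.
  by rewrite /vv /iy -/(unsplit (inl _)) unsplitK enum_rankK.
have vvt t y j : vv t y (it j) = t j.
  by rewrite /vv /it -/(unsplit (inr _)) unsplitK enum_rankK.
pose G := ideal_gen (range (mpeval p)).
have idG : is_ideal G by apply: ideal_span.
have [_ GD GM] := idG.
have Gt t i : G (\sum_j q i j * (if j == j0 then 1 else t j)).
  have -> : \sum_j q i j * (if j == j0 then 1 else t j) =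
            mpeval p (vv t (fun i' => (i' == i)%:R)).
    rewrite pE (bigD1 i) //= [X in _ = _ + X]big1 ?addr0 => [|i' /negPf ni].
      by apply: eq_bigr => j _; rewrite vvy vvt eqxx mulr1.
    by apply: big1 => j _; rewrite vvy ni mulr0.
  by apply: span_inc; exists (vv t (fun i' => (i' == i)%:R)).
have Gj0 i : G (q i j0).
  have := Gt (fun=> 0) i; rewrite (bigD1 j0) //= eqxx mulr1 big1 ?addr0 //.
  by move=> j /negPf ->; rewrite mulr0.
have Gq i j : G (q i j).
  have [->//|nj] := eqVneq j j0.
  have := Gt (fun j' => (j' == j)%:R) i; rewrite (bigD1 j0) //= eqxx mulr1.
  rewrite (bigD1 j) //= (negPf nj) eqxx mulr1 big1 ?addr0 => [Gs|j'].
    by apply: (idealDr (y := q i j0) idG); rewrite 1?addrC.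
  by case/andP=> /negPf -> /negPf ->; rewrite mulr0.
have GT : G = setT.
  apply/seteqP; split=> // x _; rewrite -[x]mulr1; apply: (GM).
  by rewrite -cq; do 2!apply: ideal_sum => // ? _; apply: (GM).
have [v [w vw]] := lgR GT.
exists (fun j => if j == j0 then 1 else v (it j)), (fun i => v (iy i) * w).
split; first by rewrite eqxx.
rewrite -[RHS]vw pE mulr_suml; apply: eq_bigr => i _.
by rewrite mulr_suml; apply: eq_bigr => j _; rewrite mulrA.
Qed.

End LocalGlobal.

Section ContentAttained.
Variable R : comPzRingType.
Hypothesis comax : forall a b : R, exists s u v, s * a = u * b /\ (1 - s) * b = v * a.

Lemma span1P (r x : R) : span ([set r] : set R^o) x -> exists z, x = r * z.
Proof. by apply: (span_min (ideal_multiples r)) => _ ->; exists 1; rewrite mulr1. Qed.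

(** With [Q] the trace-one matrix of the family of entries of [V], solve the bilinear equation
    modulo [r]. The symmetry of [Q] rewrites each term of [S * V i j] as a multiple of an entry of
    [V *m t], and [S] is 1 modulo [r]. *)
Lemma local_global_content_attained (r : R) :
  local_global (quot_ring [set r]) -> content_attained r.
Proof.
move=> lg n p V j0; case: n V => [|n] V.
  by exists (delta_mx j0 0); split=> [|[]//]; rewrite mxE !eqxx.
have [Q [Q1 Qs]] := trace_one_family comax (ord0, j0) (fun k : 'I_n.+1 * 'I_p => V k.1 k.2).
pose f : {rmorphism R -> quot_ring [set r]} := @quot_class R [set r].
have [|t [y [t0 ty]]] := @bilinear_represents_one _ lg _ _
    (fun (k : ('I_n.+1 * 'I_p) * 'I_n.+1) j => f (Q k.1 (k.2, j))) j0
    (fun k j => (k.1 == (k.2, j))%:R).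
  have f1 : f 1 = 1 by exact: rmorph1.
  rewrite -(pair_bigA _ (fun a i => \sum_j (a == (i, j))%:R * f (Q a (i, j)))) /=.
  rewrite -[RHS]f1 -Q1 rmorph_sum /=; apply: eq_bigr => a _.
  rewrite (pair_bigA _ (fun i j => (a == (i, j))%:R * f (Q a (i, j)))) /=.
  rewrite (bigD1 a) //= -surjective_pairing eqxx mul1r big1 ?addr0 // => k nk.
  by rewrite -surjective_pairing eq_sym (negPf nk) mul0r.
(* At [j0] the coefficient must be exactly 1, whereas a chosen representative would be 1 only modulo
   [r]. *)
pose t' j : R := if j == j0 then 1 else repr (t j).
pose y' k : R := repr (y k).
have ft j : f (t' j) = t j.
  rewrite /t'; case: eqP => [->|_]; first by rewrite t0; exact: rmorph1.
  exact: quot_classK.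
have fy k : f (y' k) = y k by exact: quot_classK.
pose S := \sum_(k : ('I_n.+1 * 'I_p) * 'I_n.+1) \sum_j Q k.1 (k.2, j) * t' j * y' k.
have [z Sz] : exists z, S - 1 = r * z.
  apply: span1P; apply/quot_class_eq0; rewrite -[quot_class _ _]/(f _) rmorphB rmorph1 -ty rmorph_sum.
  apply/eqP; rewrite subr_eq0; apply/eqP; apply: eq_bigr => k _.
  rewrite rmorph_sum; apply: eq_bigr => j _.
  by rewrite !rmorphM ft fy.
exists (\col_j t' j); split=> [|i j]; first by rewrite mxE /t' eqxx.
exists (- z * V i j).
have -> : V i j - r * (- z * V i j) = S * V i j.
  by rewrite -[S](subrK 1) Sz; ring.
rewrite mulr_suml; apply: ideal_sum => // -[a i'] _.
have -> : (\sum_j0 Q a (i', j0) * t' j0 * y' (a, i')) * V i j =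
   (Q a (i, j) * y' (a, i')) * (V *m \col_j t' j) i' 0.
  rewrite mxE mulr_sumr mulr_suml; apply: eq_bigr => l _.
  rewrite mxE; transitivity (Q a (i', l) * V i j * (t' l * y' (a, i'))); first by ring.
  by rewrite (Qs a (i', l) (i, j)) /=; ring.
by case: (content_ideal (V *m \col_j t' j)) => _ _; apply; apply: content_entry.
Qed.

End ContentAttained.

(** * Reduction to domains *)

Section Relations.
Variables (R : comPzRingType) (V : lmodType R).

Definition lincomb n (m : 'I_n -> V) (u : 'cV[R]_n) : V := \sum_i u i 0 *: m i.

Lemma lincombD n (m : 'I_n -> V) u v : lincomb m (u + v) = lincomb m u + lincomb m v.
Proof.
by rewrite /lincomb -big_split; apply: eq_bigr => i _; rewrite mxE scalerDl.
Qed.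

Lemma lincombZ n (m : 'I_n -> V) a u : lincomb m (a *: u) = a *: lincomb m u.
Proof.
by rewrite /lincomb scaler_sumr; apply: eq_bigr => i _; rewrite mxE scalerA.
Qed.

Lemma lincomb_mul n p (m : 'I_n -> V) (A : 'M_(n, p)) u :
  lincomb m (A *m u) = lincomb (fun j => lincomb m (col j A)) u.
Proof.
rewrite /lincomb; under eq_bigr do rewrite mxE scaler_suml.
rewrite exchange_big; apply: eq_bigr => j _; rewrite scaler_sumr.
by apply: eq_bigr => i _; rewrite scalerA mxE mulrC.
Qed.

Lemma eq_lincomb n (m m' : 'I_n -> V) u : m =1 m' -> lincomb m u = lincomb m' u.
Proof. by move=> e; apply: eq_bigr => i _; rewrite e. Qed.

Lemma lincomb_delta n (m : 'I_n -> V) j : lincomb m (delta_mx j 0) = m j.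
Proof.
rewrite /lincomb (bigD1 j) //= mxE !eqxx scale1r big1 ?addr0 // => i /negPf ni.
by rewrite mxE ni scale0r.
Qed.

Lemma span_lincomb n (m : 'I_n -> V) x :
  span (range m) x <-> exists u, x = lincomb m u.
Proof.
split=> [[k [c [v [vm ->]]]]|[u ->]].
  have /choice[s sv] : forall i, exists j, m j = v i by move=> i; have [j _ <-] := vm i; exists j.
  exists (\sum_i c i *: delta_mx (s i) 0).
  rewrite /lincomb; under [RHS]eq_bigr do rewrite summxE scaler_suml.
  rewrite exchange_big; apply: eq_bigr => i _ /=.
  rewrite -sv -(lincomb_delta m) /lincomb scaler_sumr.
  by apply: eq_bigr => j _; rewrite [in RHS]mxE scalerA.
by exists n, (fun i => u i 0), m; split=> // i; exists i.
Qed.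

End Relations.

Section Presentation.
Variables (R : comPzRingType) (V : lmodType R).

(** Finite presentation does not depend on the generators. The relations of [m] are spanned by the
    translated relations of the given presentation and by the columns of [1%:M - PM *m QM], which
    compare each generator with its rewriting back and forth. *)
Lemma fin_pres_relations (N : set V) n (m : 'I_n -> V) :
  fin_pres N -> span (range m) = N ->
  exists p (W : 'M_(n, p)), forall u, lincomb m u = 0 <-> exists z, u = W *m z.
Proof.
move=> [n0 [f [fN [l [g kf]]]]] mN.
have fE u : f u = lincomb (fun i => f (delta_mx 0 i)) u^T.
  rewrite [in LHS](row_sum_delta u) linear_sum; apply: eq_bigr => i _.
  by rewrite linearZ mxE.
have /choice[P fP] : forall i, exists u, f (delta_mx 0 i) = lincomb m u.
  by move=> i; apply/span_lincomb; rewrite mN -fN; exists (delta_mx 0 i).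
have /choice[Q mQ] : forall j, exists u, m j = f u.
  move=> j; have : N (m j) by rewrite -mN; apply: span_inc; exists j.
  by rewrite -fN => -[u _ <-]; exists u.
pose PM : 'M_(n, n0) := \matrix_(i, j) P j i 0.
pose QM : 'M_(n0, n) := \matrix_(i, j) Q j 0 i.
pose GM : 'M_(n0, l) := \matrix_(i, j) g j 0 i.
have fPM u : f u = lincomb m (PM *m u^T).
  rewrite fE lincomb_mul; apply: eq_lincomb => j; rewrite fP; congr lincomb.
  by apply/colP => i; rewrite !mxE.
have mQM u : lincomb m u = f (QM *m u)^T.
  rewrite fE trmxK lincomb_mul; apply: eq_lincomb => j; rewrite mQ fE.
  by congr lincomb; apply/colP => i; rewrite !mxE.
have ker0 u : f u = 0 <-> exists z, u^T = GM *m z.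
  have -> : (f u = 0) = span (range g) u.
    by rewrite -[LHS]/([set u | f u = 0] u) kf.
  rewrite span_lincomb; split=> -[z e]; exists z; last first.
    rewrite -[u]trmxK e; apply/rowP => i; rewrite !mxE summxE.
    by apply: eq_bigr => j _; rewrite !mxE mulrC.
  rewrite e; apply/colP => i; rewrite !mxE summxE.
  by apply: eq_bigr => j _; rewrite !mxE mulrC.
exists (l + n)%N, (row_mx (PM *m GM) (1%:M - PM *m QM)) => u; split.
  rewrite mQM => /ker0[z]; rewrite trmxK => e.
  exists (col_mx z u); rewrite mul_row_col mulmxBl mul1mx -!mulmxA e.
  by rewrite addrC subrK.
move=> [z ->]; rewrite -[z]vsubmxK mul_row_col lincombD -mulmxA.
rewrite -{1}[GM *m _]trmxK -fPM (iffRL (ker0 _)) ?add0r; last first.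
  by exists (usubmx z); rewrite trmxK.
rewrite mulmxBl mul1mx lincombD -scaleN1r lincombZ scaleN1r.
by rewrite -mulmxA -{1}[QM *m _]trmxK -fPM -mQM subrr.
Qed.

End Presentation.

Section SemihereditaryRing.
Variable R : comPzRingType.
Hypothesis cohR : coherent R.
Hypothesis redR : reduced R.
Hypothesis comax : forall a b : R, exists s u v, s * a = u * b /\ (1 - s) * b = v * a.

(** Equivalently, every principal ideal is projective. *)
Definition idempotent_annihilators (S : comPzRingType) :=
  forall a : S, exists e, [/\ e * e = e, e * a = 0 & forall x, x * a = 0 -> x = e * x].

(** Coherence makes the annihilator of [a] finitely generated. For each generator, comaximality and
    reducedness give an [f j] that fixes [a] and kills the generator; the product of the [f j] is
    the complement of the desired idempotent. *)
Lemma coherent_annihilators : idempotent_annihilators R.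
Proof.
move=> a; pose m (_ : 'I_1) : R^o := a.
have [|p [W hW]] := @fin_pres_relations R R^o (span (range m)) 1 m _ erefl.
  by apply: cohR; exists 1%N, m.
have annE x : x * a = 0 <-> exists z, x%:M = W *m z.
  rewrite -hW /lincomb big_ord1 mxE eqxx mulr1n; exact: iff_refl.
have sq0 (x : R) : x * x = 0 -> x = 0 by move=> xx; apply: (redR (k := 2)).
have Wa j : W 0 j * a = 0.
  apply/annE; exists (delta_mx j 0); rewrite -colE.
  by apply/matrixP => i k; rewrite !ord1 !mxE eqxx.
have /choice[f hf] : forall j, exists c, (1 - c) * a = 0 /\ c * W 0 j = 0.
  move=> j; have [s [u [v [sa sb]]]] := comax a (W 0 j).
  exists (1 - s); split; apply: sq0.
    transitivity (s * (W 0 j * a) * u); last by rewrite Wa mulr0 mul0r.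
    by rewrite opprB addrC subrK {2}sa; ring.
  transitivity ((1 - s) * (W 0 j * a) * v); last by rewrite Wa mulr0 mul0r.
  by rewrite {2}sb; ring.
pose F := \prod_j f j.
have Fa : F * a = a.
  rewrite /F; elim/big_rec: _ => [|j x _ IH]; first by rewrite mul1r.
  rewrite -mulrA IH; apply/esym/subr0_eq; rewrite -[X in X - _]mul1r -mulrBl.
  exact: (hf j).1.
have FW j : F * W 0 j = 0.
  by rewrite /F (bigD1 j) //= mulrAC (hf j).2 mul0r.
have ann x : x * a = 0 -> x = (1 - F) * x.
  move=> /annE[z /matrixP/(_ 0 0)]; rewrite !mxE eqxx mulr1n => xz.
  suff: F * x = 0 by move=> Fx; rewrite mulrBl mul1r Fx subr0.
  by rewrite xz mulr_sumr big1 // => j _; rewrite mulrA FW mul0r.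
have ea : (1 - F) * a = 0 by rewrite mulrBl mul1r Fa subrr.
by exists (1 - F); split=> //; rewrite -ann.
Qed.

End SemihereditaryRing.

Section Glueing.
Variable R : comPzRingType.
Hypothesis annR : idempotent_annihilators R.
Hypothesis attR : forall r : R, regular r -> content_attained r.

(** Adding the idempotent that generates the annihilator of [r] makes [r] regular, so facts known
    modulo regular elements become usable for arbitrary ones. *)
Lemma regular_shift (r e : R) : e * e = e -> e * r = 0 ->
  (forall x, x * r = 0 -> x = e * x) -> regular (r + e).
Proof.
move=> ee er ann x rx.
have ex : e * x = 0.
  have : e * ((r + e) * x) = 0 by rewrite rx mulr0.
  by rewrite mulrA mulrDr er add0r ee.
rewrite (ann x) //; move: rx.
by rewrite mulrDl ex addr0 mulrC.
Qed.

(** Replace [u] by the regular [u1], which is congruent to it modulo the content. Some row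
    combination [rho] of [W] has content comaximal to [u1]; in a basis where [rho] gives the first
    row, diag(u1, 1, .., 1) is the required matrix. *)
Lemma glued_det_realizable : det_realizable R.
Proof.
move=> n p W u u' cu.
have [e [ee eu ann]] := annR u.
have [W0 WD WM] := content_ideal W.
have ce : content W e.
  have -> : e = e * (1 - u * u') by rewrite mulrBr mulr1 mulrA eu mul0r subr0.
  exact: WM.
pose u1 := u + e.
have cu1 : content W (1 - u1 * u').
  have -> : 1 - u1 * u' = (1 - u * u') + (- u') * e by rewrite /u1; ring.
  by apply: (WD) => //; apply: WM.
have [t [t0 ct]] := attR (regular_shift ee eu ann) W^T (0 : 'I_n.+1).
pose rho : 'rV[R]_(1 + n) := t^T.
pose J := ideal_adjoin (content (rho *m W)) u1.
have idJ : is_ideal J by apply: ideal_adjoin_ideal.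
have WJ i j : J (W i j).
  have [z cz] := ct j i; exists (W i j - u1 * z), z; split; last by ring.
  have [Q] := cz; rewrite mxE => ->; exists Q^T.
  by rewrite -[RHS]mxtrace_tr !trmx_mul !trmxK mxtrace_mulC.
have [c [b [[Q ->]]]] : J 1.
  rewrite -(subrK (u1 * u') 1); have [_ JD JM] := idJ; apply: JD.
    exact: (content_min idJ WJ).
  by rewrite mulrC; apply: JM; apply: mem_ideal_adjoin.
rewrite trace_mx11 => e1.
pose y := rsubmx rho.
have rhoE : rho = row_mx 1%:M y.
  rewrite -[LHS]hsubmxK; congr row_mx; apply/matrixP => i j.
  by rewrite !ord1 !mxE eqxx -t0; congr (t _ _); apply: val_inj.
pose S : 'M[R]_(1 + n) := block_mx 1%:M y 0 1%:M.
pose S' : 'M[R]_(1 + n) := block_mx 1%:M (- y) 0 1%:M.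
have SS' : S *m S' = 1%:M.
  rewrite mulmx_block !mulmx1 !mulmx0 !mul0mx !mul1mx !addr0 !add0r addNr.
  by rewrite -scalar_mx_block.
pose d : 'M[R]_(1 + n) := block_mx u1%:M 0 0 1%:M.
have rS : usubmx (S *m W) = rho *m W.
  by rewrite -[W in LHS](@vsubmxK _ 1 n) mul_block_col col_mxKu rhoE
     -[W in RHS](@vsubmxK _ 1 n) mul_row_col.
exists (S' *m d *m S); split.
  have WE : W = S' *m (S *m W) by rewrite mulmxA (mulmx1C SS') mul1mx.
  rewrite WE; apply: unimodular_conj (mulmx1C SS') SS' _.
  exists (block_mx b%:M 0 (- dsubmx (S *m W *m Q)) 1%:M), (row_mx Q 0).
  rewrite mul_mx_row mulmx0 -[S *m W *m Q](@vsubmxK _ 1 n) col_mxKd.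
  rewrite mulmx_block !mulmx0 !mul0mx !mul1mx !addr0 !add0r.
  set U := usubmx _; have UE : U = rho *m W *m Q by rewrite /U -mul_usub_mx rS.
  have -> : row_mx (col_mx U (dsubmx (S *m W *m Q))) 0 =
            block_mx U 0 (dsubmx (S *m W *m Q)) 0 :> 'M_(1 + n).
    by rewrite (@block_mxEh _ 1 n 1 n) (@col_mx0 _ 1 n n).
  rewrite add_block_mx addr0 addNr addr0 -scalar_mxM [RHS](@scalar_mx_block _ 1 n 1).
  congr block_mx; apply/matrixP => i j.
  by rewrite !ord1 UE [LHS]mxE [X in X + _]mxE [RHS]mxE eqxx !mulr1n addrC [u1 * b]mulrC -e1.
have dSS : \det S' * \det S = 1 by apply: det_inv; apply: mulmx1C.
rewrite !det_mulmx mulrAC dSS mul1r /d (@det_ublock _ 1 n) det1 mulr1 det_scalar1.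
by rewrite /u1 addrC addKr.
Qed.

(* Maximal among the ideals that are generated by idempotents and modulo which
   the lifting problem has no solution: such an ideal is prime, because in a
   ring with idempotent annihilators it contains [e] or [1 - e] for each
   idempotent [e]. *)
Lemma glued_det_liftable : det_liftable R.
Proof.
move=> n p A W U dA; apply: contrapT => nsol.
pose idem_gen (I : set R) := forall x, I x -> exists e, [/\ I e, e * e = e & x = e * x].
pose sol (I : set R) := exists Z, I (\det (A + W *m Z) - 1).
have [||I [[idI genI nI] maxI]] := @maximal_above R
    [set I | [/\ is_ideal I, idem_gen I & ~ sol I]] [set 0].
- split.
  + split=> [|_ _ -> ->|a _ ->]; rewrite ?addr0 ?mulr0 //.
  + by move=> _ ->; exists 0; rewrite mulr0.
  + by move=> [Z /subr0_eq e]; apply: nsol; exists Z.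
- move=> F F0 FP Ftot; split.
  + by apply: ideal_chain => // X /FP[].
  + move=> x [X FX Xx]; have [_ gX _] := FP X FX; have [e [Xe ee xe]] := gX x Xx.
    by exists e; split=> //; exists X.
  + by move=> [Z [X FX XZ]]; have [_ _ nX] := FP X FX; apply: nX; exists Z.
have [I0 ID IM] := idI.
have adj_gen e : e * e = e -> idem_gen (ideal_adjoin I e).
  move=> ee _ [i [a [Ii ->]]]; have [f [If ff fi]] := genI i Ii.
  (* The join of the idempotents [f] and [e], which fixes everything that either of them fixes. *)
  exists (f + (1 - f) * e); split.
  - by exists f, (1 - f).
  - transitivity (f * f + (f - f * f) * (e + e) + (1 - f - (f - f * f)) * (e * e)).
      by ring.
    by rewrite ff ee; ring.
  - transitivity (f * i + f * a * e + e * i - e * (f * i) + a * (e * e) - f * a * (e * e)).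
      by rewrite -fi ee; ring.
    by ring.
have dich e : e * e = e -> I e \/ I (1 - e).
  move=> ee; have [Ie|nIe] := pselect (I e); [by left|right].
  apply: contrapT => nIe'.
  have ee' : (1 - e) * (1 - e) = 1 - e.
    by transitivity (1 - e - (e - e * e)); [ring | rewrite ee subrr subr0].
  have solv f : f * f = f -> ~ I f -> sol (ideal_adjoin I f).
    move=> ff nf; apply: contrapT => ns; apply: nf.
    apply: (maxI (ideal_adjoin I f)); first exact: sub_ideal_adjoin.
      by split=> //; [apply: ideal_adjoin_ideal | apply: adj_gen].
    exact: mem_ideal_adjoin.
  have [Z1 h1] := solv e ee nIe; have [Z2 h2] := solv _ ee' nIe'.
  (* The glued matrix agrees with [Z1] modulo [e] and with [Z2] modulo [1 - e], so it solves the
     problem modulo both adjoined ideals, which intersect in [I]. *)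
  apply: nI; exists ((1 - e) *: Z1 + e *: Z2).
  pose Z := (1 - e) *: Z1 + e *: Z2.
  have near f Y : f * f = f -> (exists X, Z - Y = f *: X) ->
      ideal_adjoin I f (\det (A + W *m Y) - 1) -> ideal_adjoin I f (\det (A + W *m Z) - 1).
    move=> ff [X eX] hY; have idf := ideal_adjoin_ideal f idI.
    have [_ JD JM] := idf.
    rewrite -(subrK (\det (A + W *m Y)) (\det (A + _))) -addrA; apply: JD => //.
    apply: det_cong => // i j.
    have -> : (A + W *m Z) i j - (A + W *m Y) i j = (W *m (Z - Y)) i j.
      by rewrite mulmxBr !mxE; ring.
    rewrite eX -scalemxAr mxE mulrC; apply: JM; exact: mem_ideal_adjoin.
  have [i [a [Ii ei]]] : ideal_adjoin I e (\det (A + W *m Z) - 1).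
    apply: near h1 => //; exists (Z2 - Z1).
    by rewrite /Z scalerBl scale1r scalerBr; apply/matrixP => k l; rewrite !mxE; ring.
  have [j [b [Ij ej]]] : ideal_adjoin I (1 - e) (\det (A + W *m Z) - 1).
    apply: near h2 => //; exists (Z1 - Z2).
    by rewrite /Z; apply/matrixP => k l; rewrite !mxE; ring.
  have -> : \det (A + W *m Z) - 1 = (1 - e) * i + e * j.
    set x := _ - 1 in ei ej *; transitivity ((1 - e) * x + e * x); first by ring.
    rewrite {1}ei ej.
    transitivity ((1 - e) * i + e * j + (a + b) * (e - e * e)); first by ring.
    by rewrite ee subrr mulr0 addr0.
  by apply: (ID); apply: (IM).
have I1 : ~ I 1 by move=> I1; apply: nI; exists 0; rewrite -[_ - 1]mulr1; apply: IM.
pose D := quot_ring I.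
pose q : {rmorphism R -> D} := @quot_class R I.
have q0 x : q x = 0 <-> I x by apply: quot_ideal_eq0.
have qK (x : D) : q (repr x) = x by apply: quot_classK.
have lift (x : D) : exists r, q r = x by exists (repr x).
have liftmx k l (M : 'M[D]_(k, l)) : exists N : 'M[R]_(k, l), map_mx q N = M.
  by exists (map_mx (fun x => repr x) M); apply/matrixP => i j; rewrite !mxE.
have content_map k l (M : 'M[R]_(k, l)) x : content M x -> content (map_mx q M) (q x).
  by move=> [Q ->]; exists (map_mx q Q); rewrite -map_mxM trace_map_mx.
have domD (x y : D) : x * y = 0 -> x = 0 \/ y = 0.
  have [a <-] := lift x; have [b <-] := lift y.
  rewrite -rmorphM => /q0/genI[e [Ie ee abE]].
  (* As [(1 - e) * a] kills [b], the idempotent [f] fixes [b] and kills [(1 - e) * a]; whichever of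
     [f], [1 - f] lies in [I] puts [b] or [a] in [I]. *)
  have [f [ff fa ann]] := annR ((1 - e) * a).
  have bf : b = f * b.
    apply: ann; transitivity (a * b - e * (a * b)); first by ring.
    by rewrite -abE subrr.
  have [If|If] := dich f ff.
    by right; apply/q0; rewrite bf mulrC; apply: IM.
  left; apply/q0; have -> : a = (1 - e) * a * (1 - f) + a * e.
    transitivity ((1 - e) * a - f * ((1 - e) * a) + a * e); last by ring.
    by rewrite fa; ring.
  by apply: (ID); apply: (IM).
have D1 : (1 : D) <> 0 by rewrite -(rmorph1 q) => /q0.
have attD (r : D) : r <> 0 -> content_attained r.
  have [a <-] := lift r => a0.
  have [e [ee ea ann]] := annR a.
  (* Otherwise [1 - e], which fixes [a], would lie in [I] and so would [a]. Hence [a] has the same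
     class as the regular element [a + e]. *)
  have Ie : I e.
    have [//|Ie] := dich e ee; exfalso; apply: a0; apply/q0.
    have -> : a = a * (1 - e) by rewrite mulrBr mulr1 [a * e]mulrC ea subr0.
    exact: IM.
  have -> : q a = q (a + e) by rewrite rmorphD (iffRL (q0 e) Ie) addr0.
  move=> k l V j0; have [V' <-] := liftmx _ _ V.
  have [t [t0 ct]] := attR (regular_shift ee ea ann) V' j0.
  exists (map_mx q t); split=> [|i j]; first by rewrite mxE t0 rmorph1.
  have [z cz] := ct i j; exists (q z).
  by rewrite mxE -map_mxM -rmorphM -rmorphB; apply: content_map.
have [Z0 hZ] : solvable (map_mx q A) (map_mx q W).
  apply: (domain_det_liftable domD D1 attD).
    have [B [C BC]] := U; exists (map_mx q B), (map_mx q C).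
    by rewrite -!map_mxM -map_mxD BC map_mx1.
  by rewrite det_map_mx -(rmorph1 q) -rmorphB; apply: content_map.
have [Z eZ] := liftmx _ _ Z0.
apply: nI; exists Z; apply/q0; rewrite rmorphB rmorph1 -det_map_mx map_mxD map_mxM eZ.
by rewrite hZ subrr.
Qed.

End Glueing.

(** * Exterior powers *)

Section RowAction.
Variables (R : comPzRingType) (M : lmodType R).
Implicit Types (n : nat).

Lemma rowactE n (m : 'rV[M]_n) A j : rowact m A 0 j = lincomb (m 0) (col j A).
Proof. by rewrite mxE; apply: eq_bigr => i _; rewrite mxE. Qed.

Lemma rowact_mul n (m : 'rV[M]_n) A B : rowact m (A *m B) = rowact (rowact m A) B.
Proof.
apply/rowP => j; rewrite !rowactE colE -mulmxA lincomb_mul -colE.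
by apply: eq_lincomb => k; rewrite rowactE.
Qed.

Lemma rowact1 n (m : 'rV[M]_n) : rowact m 1%:M = m.
Proof. by apply/rowP => j; rewrite rowactE colE mul1mx lincomb_delta. Qed.

Definition setcol n (A : 'M[R]_n) j (c : 'cV_n) : 'M_n :=
  \matrix_(i, k) if k == j then c i 0 else A i k.

Lemma setcol_id n (A : 'M[R]_n) j : setcol A j (col j A) = A.
Proof. by apply/matrixP => i k; rewrite !mxE; case: eqP => [->|]. Qed.

Lemma det_setcol n (A : 'M[R]_n) j c :
  \det (setcol A j c) = \sum_i c i 0 * cofactor A i j.
Proof.
rewrite (expand_det_col _ j); apply: eq_bigr => i _; rewrite mxE eqxx.
congr (_ * (_ * \det _)); apply/matrixP => k l.
by rewrite !mxE eq_sym (negPf (neq_lift _ _)).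
Qed.

Lemma rowact_setcol n (m : 'rV[M]_n) A j c :
  rowact m (setcol A j c) = upd (rowact m A) j (lincomb (m 0) c).
Proof.
apply/rowP => k; rewrite rowactE [RHS]mxE; case: eqP => [->|kj].
  by congr lincomb; apply/colP => i; rewrite !mxE eqxx.
by rewrite rowactE; congr lincomb; apply/colP => i; rewrite !mxE; case: eqP.
Qed.

Lemma upd_id n (m : 'rV[M]_n) i : upd m i (m 0 i) = m.
Proof. by apply/rowP => j; rewrite mxE; case: eqP => [->|]. Qed.

Lemma upd_upd n (m : 'rV[M]_n) i x y : upd (upd m i x) i y = upd m i y.
Proof. by apply/rowP => j; rewrite !mxE; case: eqP. Qed.

Lemma updC n (m : 'rV[M]_n) i j x y : i != j ->
  upd (upd m i x) j y = upd (upd m j y) i x.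
Proof.
move=> ij; apply/rowP => k; rewrite !mxE.
by case: (eqVneq k j) => [->|//]; rewrite eq_sym (negPf ij).
Qed.

End RowAction.

Section Alternating.
Variables (R : comPzRingType) (M V : lmodType R) (n : nat) (w : 'rV[M]_n -> V).
Hypothesis wlin : forall m i (a : R) x y,
  w (upd m i (a *: x + y)) = a *: w (upd m i x) + w (upd m i y).
Hypothesis walt : forall (m : 'rV[M]_n) i j, i != j -> m 0 i = m 0 j -> w m = 0.

Lemma alt_upd0 m i : w (upd m i 0) = 0.
Proof.
have := wlin m i 1 0 0; rewrite !scale1r addr0 => e.
by apply: (addrI (w (upd m i 0))); rewrite addr0 -e.
Qed.

Lemma alt_lincomb m j k (y : 'I_k -> M) c :
  w (upd m j (lincomb y c)) = \sum_i c i 0 *: w (upd m j (y i)).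
Proof.
rewrite /lincomb; elim/big_rec2: _ => [|i z u _ <-]; first exact: alt_upd0.
exact: wlin.
Qed.

(** Polarization: put the sum of the two entries in both places and expand. *)
Lemma alt_tperm (m : 'rV[M]_n) i j : i != j -> w (upd (upd m i (m 0 j)) j (m 0 i)) = - w m.
Proof.
move=> ij; have ji : j != i by rewrite eq_sym.
pose u p q := w (upd (upd m i p) j q).
have uD p x y : u p (x + y) = u p x + u p y.
  by rewrite /u -{1}[x]scale1r wlin scale1r.
have Du x y q : u (x + y) q = u x q + u y q.
  by rewrite /u !(updC _ _ _ ij) -{1}[x]scale1r wlin scale1r.
have uu x : u x x = 0.
  by apply: (walt ij); rewrite !mxE eqxx (negPf ij) eqxx.
have u0 : u (m 0 i) (m 0 j) = w m.
  by rewrite /u upd_id upd_id.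
have := uu (m 0 i + m 0 j); rewrite Du !uD !uu u0 addr0 add0r => /eqP.
by rewrite addrC addr_eq0 => /eqP.
Qed.

Lemma alt_perm (s : {perm 'I_n}) (m : 'rV[M]_n) : w (\row_j m 0 (s j)) = (-1) ^+ s *: w m.
Proof.
have [ts -> dts] := prod_tpermP s.
elim: ts dts m => [|[i j] ts IH] /= => [_|/andP[ij dts]] m.
  rewrite big_nil odd_perm1 scale1r; congr w; apply/rowP => j.
  by rewrite mxE perm1.
rewrite big_cons /= odd_mul_tperm ij signr_addb -scalerA -IH //.
pose m' := \row_k m 0 ((\prod_(t <- ts) tperm t.1 t.2)%g k).
have -> : \row_k m 0 ((tperm i j * \prod_(t <- ts) tperm t.1 t.2)%g k) =
   upd (upd m' i (m' 0 j)) j (m' 0 i).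
  apply/rowP => k; rewrite !mxE permM.
  case: tpermP => [->|->|/eqP ki /eqP kj]; rewrite ?eqxx //.
    by rewrite (negPf ij).
  by rewrite (negPf ki) (negPf kj).
by rewrite alt_tperm // expr1 scaleN1r.
Qed.

Lemma alt_rowact m A : w (rowact m A) = \det A *: w m.
Proof.
(* Induction on the number [k] of leading columns allowed to be arbitrary, the others being unit
   vectors. Expanding one more column on the left matches the cofactor expansion of the determinant
   on the right. *)
suff H k : forall A : 'M[R]_n,
    (forall j : 'I_n, (k <= j)%N -> exists i, col j A = delta_mx i 0) ->
    w (rowact m A) = \det A *: w m.
  by apply: (H n) => j; rewrite leqNgt ltn_ord.
elim: k => [|k IH] {}A Ad.
  have /choice[s hs] : forall j, exists i, col j A = delta_mx i 0 by move=> j; apply: Ad.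
  have rA : rowact m A = \row_j m 0 (s j).
    by apply/rowP => j; rewrite rowactE hs lincomb_delta mxE.
  have Aij i j : A i j = (i == s j)%:R.
    by have /colP/(_ i) := hs j; rewrite !mxE andbT.
  have [inj|] := pselect (injective s).
    have -> : A = (perm_mx (perm inj))^T.
      by apply/matrixP => i j; rewrite Aij !mxE permE eq_sym.
    rewrite det_tr det_perm -alt_perm; congr w.
    apply/rowP => j; rewrite rowactE [RHS]mxE permE -[RHS](lincomb_delta (m 0)).
    congr lincomb; apply/colP => i.
    by rewrite !mxE permE eq_sym andbT.
  move=> /existsNP[i /existsNP[j /not_implyP[sij /eqP ij]]].
  rewrite (walt ij) ?rA ?mxE ?sij // -det_tr (determinant_alternate ij) ?scale0r //.
  by move=> l; rewrite !mxE !Aij sij.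
have [kn|nk] := ltnP k n; last first.
  by apply: IH => j; rewrite leqNgt (leq_trans (ltn_ord j) nk).
pose j0 := Ordinal kn.
rewrite -(setcol_id A j0) rowact_setcol alt_lincomb det_setcol scaler_suml.
apply: eq_bigr => i _; rewrite -scalerA; congr (_ *: _).
have -> : cofactor A i j0 = \det (setcol A j0 (delta_mx i 0)).
  rewrite det_setcol (bigD1 i) //= mxE !eqxx mul1r big1 ?addr0 // => l /negPf li.
  by rewrite mxE li mul0r.
rewrite -(lincomb_delta (m 0) i) -rowact_setcol; apply: IH => j kj.
have [->|jj] := eqVneq j j0.
  by exists i; apply/colP => l; rewrite !mxE !eqxx.
have [|l hl] := Ad j; first by rewrite ltn_neqAle kj eq_sym andbT.
by exists l; rewrite -hl; apply/colP => l'; rewrite !mxE (negPf jj).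
Qed.

End Alternating.

Lemma quot_lmod0 (R : pzRingType) (V : lmodType R) (A : set V) :
  \pi_(quot_lmod A) 0 = 0.
Proof.
by rewrite -(scale0r (\pi_(quot_lmod A) 0)) [RHS]quot_scaleE scale0r.
Qed.

Section Wedge.
Variables (R : comPzRingType) (M : lmodType R) (n : nat).

Let rel := multilinear_rel (M := M) (n := n) `|` alternating_rel (M := M) (n := n).

Lemma wedge_lin (m : 'rV[M]_n) i a x y :
  wedge (upd m i (a *: x + y)) = a *: wedge (upd m i x) + wedge (upd m i y).
Proof.
have -> : a *: wedge (upd m i x) + wedge (upd m i y) =
  \pi_(quot_lmod rel) (a *: free_gen R (upd m i x) + free_gen R (upd m i y)).
  by rewrite -quot_addE -quot_scaleE.
apply/eqP; rewrite quot_lmodE; apply/span_predP/span_inc; left.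
by exists m, i, a, x, y.
Qed.

Lemma wedge_alt (m : 'rV[M]_n) i j : i != j -> m 0 i = m 0 j -> wedge m = 0.
Proof.
move=> ij mij; rewrite -(quot_lmod0 rel).
apply/eqP; rewrite quot_lmodE subr0; apply/span_predP/span_inc; right.
by exists m, i, j.
Qed.

Lemma wedge_rowact (m : 'rV[M]_n) A : wedge (rowact m A) = \det A *: wedge m.
Proof. exact: alt_rowact wedge_lin wedge_alt m A. Qed.

Lemma wedge_eq0 (m : 'rV[M]_n) a : a *: wedge m = 0 -> span rel (a *: free_gen R m).
Proof.
have -> : a *: wedge m = \pi_(quot_lmod rel) (a *: free_gen R m).
  by rewrite -quot_scaleE.
rewrite -(quot_lmod0 rel).
by move/eqP; rewrite quot_lmodE subr0 => /span_predP.
Qed.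

End Wedge.

Section FreeFunctional.
Variables (R : comPzRingType) (K : choiceType) (F : K -> R).

Definition free_eval (z : freemod R K) : R := \sum_(k <- msupp z) z@_k * F k.

Lemma free_evalE (d : {fset K}) (z : freemod R K) :
  (msupp z `<=` d)%fset -> free_eval z = \sum_(k <- d) z@_k * F k.
Proof.
move=> zd; rewrite /free_eval (big_fset_incl _ zd) // => k _ kz.
by rewrite mcoeff_outdom // mul0r.
Qed.

Lemma free_evalD z z' : free_eval (z + z') = free_eval z + free_eval z'.
Proof.
rewrite (free_evalE (msuppD_le z z')) (free_evalE (fsubsetUl (msupp z) (msupp z'))).
rewrite (free_evalE (fsubsetUr (msupp z) (msupp z'))) -big_split /=.
by apply: eq_bigr => k _; rewrite mcoeffD mulrDl.
Qed.

Lemma free_evalZ a z : free_eval (a *: z) = a * free_eval z.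
Proof.
have sub : (msupp (a *: z) `<=` msupp z)%fset.
  apply/fsubsetP => k; rewrite -!mcoeff_neq0; apply: contraNneq => zk.
  by rewrite (free_scaleE a z k) zk mulr0.
rewrite (free_evalE sub) mulr_sumr; apply: eq_bigr => k _.
by rewrite (free_scaleE a z k) mulrA.
Qed.

Lemma free_eval_gen k : free_eval (free_gen R k) = F k.
Proof. by rewrite (free_evalE msuppU_le) big_seq_fset1 mcoeffU eqxx mul1r. Qed.

Lemma free_eval0 : free_eval 0 = 0.
Proof. by rewrite /free_eval msupp0 big_seq_fset0. Qed.

Lemma free_eval_span (J : set R) (A : set (freemod R K)) z :
  is_ideal J -> (forall x, A x -> J (free_eval x)) -> span A z -> J (free_eval z).
Proof.
move=> idJ AJ [k [c [v [Av ->]]]]; have [J0 JD JM] := idJ.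
elim/big_rec: _ => [|i y _ Jy]; first by rewrite free_eval0.
by rewrite free_evalD free_evalZ; apply: (JD) => //; apply: (JM); apply: AJ.
Qed.

End FreeFunctional.

Section WedgeAnnihilator.
Variables (R : comPzRingType) (M : lmodType R) (n p : nat).
Variables (m : 'rV[M]_n) (W : 'M[R]_(n, p)).
Hypothesis genm : forall x, exists u, x = lincomb (m 0) u.
Hypothesis relm : forall u, lincomb (m 0) u = 0 <-> exists z, u = W *m z.

Lemma rowact_gen x : exists A, x = rowact m A.
Proof.
have /choice[f hf] : forall j, exists u, x 0 j = lincomb (m 0) u by move=> j.
exists (\matrix_(i, j) f j i 0); apply/rowP => j; rewrite rowactE hf.
by congr lincomb; apply/colP => i; rewrite !mxE.
Qed.

Lemma rowact_eq A B : rowact m A = rowact m B -> exists C, A = B + W *m C.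
Proof.
move=> e; have /choice[f hf] : forall j, exists z, col j (A - B) = W *m z.
  move=> j; apply/relm; rewrite raddfB /= lincombD -scaleN1r lincombZ scaleN1r.
  by rewrite -!rowactE e subrr.
exists (\matrix_(i, j) f j i 0); apply/matrixP => i j.
have /colP/(_ i) := hf j; rewrite !mxE => e'; rewrite -[LHS](subrK (B i j)) e' addrC.
by congr (_ + _); apply: eq_bigr => k _; rewrite mxE.
Qed.

Lemma rowact_rel A Z : rowact m (A + W *m Z) = rowact m A.
Proof.
apply/rowP => j; rewrite !rowactE raddfD /= lincombD [col j (W *m Z)]colE -mulmxA.
by rewrite (iffRL (relm (W *m _))) ?addr0 //; exists (Z *m delta_mx j 0).
Qed.

Lemma det_rowact_eq A B : rowact m A = rowact m B -> content W (\det A - \det B).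
Proof. by move=> /rowact_eq[C ->]; apply: det_content. Qed.

(** Choose for each vector [x] a matrix [N x] with [x = rowact m (N x)]. Modulo the content its
    determinant does not depend on the choice, so it kills the defining relations of the exterior
    power, and it takes the value 1 at [m]. *)
Lemma wedge_annihilator a : a *: wedge m = 0 -> content W a.
Proof.
have /choice[N hN] := rowact_gen.
move/wedge_eq0 => sp.
have idW := content_ideal W; have [_ WD WM] := idW.
have := @free_eval_span R _ (fun x => \det (N x)) (content W) _ _ idW _ sp.
rewrite free_evalZ free_eval_gen => H.
have Nm : content W (1 - \det (N m)).
  by rewrite -[1](det1 R n); apply: det_rowact_eq; rewrite rowact1 -hN.
suff Ja : content W (a * \det (N m)).
  have -> : a = a * \det (N m) + a * (1 - \det (N m)) by ring.
  by apply: (WD) => //; apply: WM.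
apply: H => _ [[x [i [c [y [z ->]]]]]|[x [i [j [ij xij ->]]]]]; last first.
  rewrite free_eval_gen.
  (* Copying column [i] onto column [j] gives another matrix representing [x], now with two equal
     columns and hence determinant 0. *)
  have e : rowact m (setcol (N x) j (col i (N x))) = x.
    by rewrite rowact_setcol -hN -rowactE -hN xij upd_id.
  rewrite -[\det _]subr0.
  have <- : \det (setcol (N x) j (col i (N x))) = 0.
    rewrite -det_tr (determinant_alternate ij) // => k.
    by rewrite !mxE eqxx (negPf ij).
  by apply: det_rowact_eq; rewrite e.
rewrite free_evalD -scaleN1r free_evalZ free_evalD free_evalZ !free_eval_gen.
set u1 := upd x i (c *: y + z); set u2 := upd x i y; set u3 := upd x i z.
have e2 : u2 0 i = lincomb (m 0) (col i (N u2)) by rewrite -rowactE -hN.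
have e3 : u3 0 i = lincomb (m 0) (col i (N u3)) by rewrite -rowactE -hN.
rewrite !mxE eqxx in e2 e3.
have d3 : content W (\det (N u3) - \det (setcol (N u2) i (col i (N u3)))).
  by apply: det_rowact_eq; rewrite rowact_setcol -!hN -e3 upd_upd.
have d1 : content W (\det (N u1) -
                     \det (setcol (N u2) i (c *: col i (N u2) + col i (N u3)))).
  apply: det_rowact_eq; rewrite rowact_setcol -!hN lincombD lincombZ -e2 -e3.
  by rewrite upd_upd.
have dd : \det (setcol (N u2) i (c *: col i (N u2) + col i (N u3))) =
          c * \det (N u2) + \det (setcol (N u2) i (col i (N u3))).
  rewrite -{3}(setcol_id (N u2) i) !det_setcol mulr_sumr -big_split /=.
  by apply: eq_bigr => k _; rewrite !mxE; ring.
have -> : \det (N u1) + -1 * (c * \det (N u2) + \det (N u3)) =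
  (\det (N u1) - \det (setcol (N u2) i (c *: col i (N u2) + col i (N u3)))) +
  -1 * (\det (N u3) - \det (setcol (N u2) i (col i (N u3)))) by rewrite dd; ring.
by apply: (WD) => //; apply: (WM).
Qed.

End WedgeAnnihilator.

(** * Orbits of generating vectors *)

Section GeneratingVectors.
Variables (R : comPzRingType) (M : lmodType R).

Lemma genvecP n (m : 'rV[M]_n) :
  genvec n M m <-> forall x, exists u, x = lincomb (m 0) u.
Proof.
split=> [gm x|H]; first by apply/span_lincomb; rewrite gm.
by apply/seteqP; split=> // x _; apply/span_lincomb.
Qed.

Lemma const_mx_genvec (x : M) :
  (forall z, exists c, z = c *: x) -> genvec 1 M (const_mx x).
Proof.
move=> gx; apply/genvecP => z; have [c ->] := gx z.
by exists c%:M; rewrite /lincomb big_ord1 !mxE eqxx.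
Qed.

Lemma genvec1P (v : 'rV[M]_1) : genvec 1 M v ->
  forall z, exists c, z = c *: v 0 0.
Proof.
move=> /genvecP gv z; have [u ->] := gv z.
by exists (u 0 0); rewrite /lincomb big_ord1.
Qed.

End GeneratingVectors.

Section Orbits.
Variables (R : comPzRingType) (M : lmodType R).

Lemma genvec_mu : (exists n, genvec n M !=set0) -> genvec (mu M) M !=set0.
Proof.
move=> ex; pose P n := `[< genvec n M !=set0 >].
have exP : exists n, P n by have [n gn] := ex; exists n; apply/asboolP.
have : exists n, genvec n M !=set0 /\ forall k, genvec k M !=set0 -> (n <= k)%N.
  case: (ex_minnP exP) => n /asboolP gn nmin; exists n; split=> // k gk.
  by apply: nmin; apply/asboolP.
by move=> /(xgetPex 0%N)[].
Qed.

Lemma fin_pres_genvec : fin_pres [set: M] -> exists n, genvec n M !=set0.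
Proof.
move=> [n [f [fT _]]]; exists n, (\row_i f (delta_mx 0 i)); apply/genvecP => x.
have [u _ <-] : range f x by rewrite fT.
exists u^T; rewrite [in LHS](row_sum_delta u) linear_sum; apply: eq_bigr => i _.
by rewrite linearZ !mxE.
Qed.

Lemma genvec_relations n (m : 'rV[M]_n) : fin_pres [set: M] -> genvec n M m ->
  exists p (W : 'M[R]_(n, p)), forall u, lincomb (m 0) u = 0 <-> exists z, u = W *m z.
Proof. by move=> hM gm; apply: fin_pres_relations hM gm. Qed.

(** Padding both factors with zeros makes them square, and the second one then has a zero row. *)
Lemma det_short n k (Q : 'M[R]_(n, k)) (P : 'M[R]_(k, n)) :
  (k < n)%N -> \det (Q *m P) = 0.
Proof.
move=> kn; have [d ed] : exists d, n = (k + d.+1)%N.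
  by exists (n - k).-1; rewrite prednK ?subn_gt0 // subnKC // ltnW.
subst n; have -> : Q *m P = row_mx Q 0 *m col_mx P (0 : 'M_(d.+1, _)).
  by rewrite mul_row_col mul0mx addr0.
rewrite det_mulmx (expand_det_row (col_mx P 0) (rshift k ord0)) big1 ?mulr0 // => j _.
by rewrite col_mxEd mxE mul0r.
Qed.

(** The vector [rowact m A] generates exactly when [m] can be recovered from it by some [B], that
    is, when the columns of [1%:M - A *m B] are relations. *)
Lemma genvec_unimodular n p (m : 'rV[M]_n) (W : 'M[R]_(n, p)) A :
  (forall u, lincomb (m 0) u = 0 <-> exists z, u = W *m z) ->
  genvec n M m -> genvec n M (rowact m A) <-> unimodular A W.
Proof.
move=> rel /genvecP gm; split=> [/genvecP gA|[B [C e]]].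
  have [B eB] := rowact_gen gA m.
  have [|C eC] := rowact_eq (m := m) rel (A := 1%:M) (B := A *m B).
    by rewrite rowact1 rowact_mul.
  by exists B, C.
apply/genvecP => x; have [u ->] := gm x.
have em : rowact (rowact m A) B = m by rewrite -rowact_mul -(rowact_rel rel _ C) e rowact1.
exists (B *m u); rewrite lincomb_mul; apply: eq_lincomb => j.
by rewrite -rowactE em.
Qed.

Hypothesis finM : fin_pres [set: M].
Hypothesis liftR : det_liftable R.

Lemma same_wedge_SL n (m m' : 'rV[M]_n) : genvec n M m -> genvec n M m' ->
  wedge m = wedge m' -> exists A, SL n A /\ m' = rowact m A.
Proof.
move=> gm gm' ew; have [p [W rel]] := genvec_relations finM gm.
have [A eA] := rowact_gen ((genvecP m).1 gm) m'.
have UA : unimodular A W by apply/(genvec_unimodular A rel gm); rewrite -eA.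
have cA : content W (\det A - 1).
  apply: (wedge_annihilator ((genvecP m).1 gm) rel).
  by rewrite scalerBl scale1r -wedge_rowact -eA ew subrr.
have [Z dZ] := liftR UA cA.
by exists (A + W *m Z); split=> //; rewrite (rowact_rel rel).
Qed.

(** Rewriting [m] through a shorter generating vector shows that [m] is fixed by a matrix factoring
    through [mu M] columns, whose determinant is 0. *)
Lemma wedge_over_mu n (m : 'rV[M]_n) : (mu M < n)%N -> genvec n M m -> wedge m = 0.
Proof.
move=> mun gm; have [m0 gm0] := genvec_mu (fin_pres_genvec finM).
have /choice[q hq] : forall j, exists u, m0 0 j = lincomb (m 0) u.
  by move=> j; apply/(genvecP m).1.
have /choice[r hr] : forall j, exists u, m 0 j = lincomb (m0 0) u.
  by move=> j; apply/(genvecP m0).1.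
pose Q : 'M[R]_(n, mu M) := \matrix_(i, j) q j i 0.
pose P : 'M[R]_(mu M, n) := \matrix_(i, j) r j i 0.
have e : rowact m (Q *m P) = m.
  apply/rowP => j; rewrite rowactE colE -mulmxA lincomb_mul hr.
  rewrite -[lincomb (m0 0) _](@eq_lincomb _ _ _ (fun j => lincomb (m 0) (col j Q))).
    by congr lincomb; rewrite -colE; apply/colP => i; rewrite !mxE.
  by move=> k; rewrite hq; congr lincomb; apply/colP => i; rewrite !mxE.
by rewrite -e wedge_rowact (det_short _ _ mun) scale0r.
Qed.

Lemma SLorbit_wedge n (m m' : 'rV[M]_n) : SLorbit m m' -> wedge m' = wedge m.
Proof. by move=> [A SA <-]; rewrite wedge_rowact SA scale1r. Qed.

Lemma SLorbit_refl n (m : 'rV[M]_n) : SLorbit m m.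
Proof. by exists 1%:M; [exact: det1 | exact: rowact1]. Qed.

Lemma SLorbit_eq n (m m' : 'rV[M]_n) : SLorbit m m' -> SLorbit m' = SLorbit m.
Proof.
move=> [A SA <-]; apply/seteqP; split=> _ [B SB <-].
  by exists (A *m B); rewrite ?rowact_mul //= /SL /= det_mulmx SA SB mulr1.
exists (\adj A *m B).
  rewrite /SL /= det_mulmx SB mulr1.
  by have := det_inv (mul_adj_det1 SA); rewrite SA mul1r.
by rewrite -rowact_mul mulmxA (mul_adj_det1 SA) mul1mx.
Qed.

(** Converse of [wedge_annihilator]: the entry [W i j] is the determinant of the identity with
    column [i] replaced by the relation [col j W], which puts 0 in place [i] of [m]. *)
Lemma content_wedge n p (m : 'rV[M]_n) (W : 'M[R]_(n, p)) a :
  (forall u, lincomb (m 0) u = 0 <-> exists z, u = W *m z) ->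
  content W a -> a *: wedge m = 0.
Proof.
move=> rel; apply: (@content_min _ _ _ W [set a | a *: wedge m = 0]) => [|i j].
  split=> /= [|x y ex ey|c x ex]; first exact: scale0r.
    by rewrite scalerDl ex ey addr0.
  by rewrite -scalerA ex scaler0.
have cW : lincomb (m 0) (col j W) = 0.
  by apply/rel; exists (delta_mx j 0); rewrite colE.
have dW : \det (setcol 1%:M i (col j W)) = W i j.
  have a1 : \adj (1%:M : 'M[R]_n) = 1%:M.
    by rewrite -[LHS]mul1mx mul_mx_adj det1.
  rewrite det_setcol (bigD1 i) //= big1 ?addr0 => [|k ki].
    by have /matrixP/(_ i i) := a1; rewrite !mxE eqxx => ->; rewrite mulr1.
  by have /matrixP/(_ i k) := a1; rewrite !mxE eq_sym (negPf ki) => ->; rewrite mulr0.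
rewrite /= -dW -wedge_rowact rowact_setcol cW.
exact: alt_upd0 (@wedge_lin _ _ _) _ _.
Qed.

Lemma free_genZ (K : choiceType) c (k : K) :
  << c *g k >> = c *: free_gen R k :> freemod R K.
Proof.
by apply/malgP => l; rewrite (free_scaleE c (free_gen R k)) !mcoeffU mulrnAr mulr1.
Qed.

Lemma wedge_generates n (m : 'rV[M]_n) (z : extpow M n) : genvec n M m ->
  exists c, z = c *: wedge m.
Proof.
move=> gm; rewrite -[z]reprK; move: (repr z) => {}z.
rewrite [z]monalgE.
elim/big_rec: _ => [|k y _ [c e]]; first by exists 0; rewrite scale0r; apply: quot_lmod0.
have [A eA] := rowact_gen ((genvecP m).1 gm) k.
exists (z@_k * \det A + c); rewrite free_genZ -quot_addE -quot_scaleE e scalerDl -scalerA.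
by rewrite -wedge_rowact -eA.
Qed.

Lemma wedge_bijection n : genvec n.+1 M !=set0 -> det_realizable R ->
  exists f : set 'rV[M]_n.+1 -> 'rV[extpow M n.+1]_1,
    (forall m, genvec n.+1 M m -> f (SLorbit m) = const_mx (wedge m)) /\
    set_bij (genvec_mod_SL n.+1 M) (genvec 1 (extpow M n.+1)) f.
Proof.
move=> [m0 gm0] realR.
(* The wedge is constant on orbits, so any chosen member computes it; the default [m0] is never
   reached on an orbit. *)
pose f (O : set 'rV[M]_n.+1) : 'rV[extpow M n.+1]_1 := const_mx (wedge (xget m0 O)).
have fE m : f (SLorbit m) = const_mx (wedge m).
  congr const_mx; apply: SLorbit_wedge.
  by apply: (@xgetPex _ m0 (SLorbit m)); exists m; apply: SLorbit_refl.
exists f; split=> [m _|]; first exact: fE.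
split.
- move=> _ [m gm <-]; rewrite fE; apply: const_mx_genvec => z.
  exact: wedge_generates.
- move=> _ _ /set_mem[m gm <-] /set_mem[m' gm' <-]; rewrite !fE => /matrixP/(_ 0 0).
  rewrite !mxE => ew; have [A [SA ->]] := same_wedge_SL gm gm' ew.
  by apply/esym/SLorbit_eq; exists A.
move=> v gv.
have [p [W rel]] := genvec_relations finM gm0.
have [c ec] := wedge_generates (v 0 0) gm0.
have [c' ec'] := genvec1P gv (wedge m0).
(* Each of [v] and the wedge of [m0] is a multiple of the other, so [c] is a unit modulo the
   annihilator, and some matrix realizes it as a determinant. *)
have cW : content W (1 - c * c').
  apply: (wedge_annihilator ((genvecP m0).1 gm0) rel).
  by rewrite scalerBl scale1r mulrC -scalerA -ec -ec' subrr.
have [A [UA dA]] := realR _ _ _ _ _ cW.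
have gA : genvec n.+1 M (rowact m0 A) by apply/(genvec_unimodular A rel gm0).
exists (SLorbit (rowact m0 A)); first by exists (rowact m0 A).
rewrite fE; apply/rowP => i; rewrite !ord1 mxE ec wedge_rowact; apply/subr0_eq.
by rewrite -scalerBl; apply: content_wedge dA.
Qed.

End Orbits.

(** * Conclusion for the two classes of rings *)

Lemma prufer_det_problems (R : comPzRingType) :
  almost_local_global R -> coherent R -> prufer R -> det_liftable R /\ det_realizable R.
Proof.
move=> alg coh [red ar].
have comax := arithmetic_comaximal ar.
have ann := coherent_annihilators coh red comax.
have att (r : R) : regular r -> content_attained r.
  by move=> regr; exact: (local_global_content_attained comax (@alg r regr)).
by split; [apply: glued_det_liftable | apply: glued_det_realizable].
Qed.

Theorem theorem1p1 (R : comPzRingType)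
  (hR : elementary_divisor_ring R \/
        [/\ almost_local_global R, coherent R & prufer R])
  (M : lmodType R) (hM : fin_pres [set: M]) :
  ((0 < mu M)%N ->
     exists f : set 'rV[M]_(mu M) -> 'rV[det_mod M]_1,
       (forall m, genvec (mu M) M m -> f (SLorbit m) = const_mx (wedge m)) /\
       set_bij (genvec_mod_SL (mu M) M) (genvec 1 (det_mod M)) f) /\
  (forall n : nat, (mu M < n)%N ->
     forall m m' : 'rV[M]_n, genvec n M m -> genvec n M m' ->
     exists A : 'M[R]_n, SL n A /\ m' = rowact m A).
Proof.
have [liftR realR] : det_liftable R /\ det_realizable R.
  case: hR => [edr|[alg coh pru]]; last exact: prufer_det_problems.
  by split; [apply: edr_det_liftable | apply: edr_det_realizable].
split=> [|n mun m m' gm gm'].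
  have := genvec_mu (fin_pres_genvec hM); rewrite /det_mod.
  case: (mu M) => [//|n] gn _.
  exact: wedge_bijection.
(* For more than [mu M] generators both wedges are 0, hence equal. *)
by apply: same_wedge_SL => //; rewrite !wedge_over_mu.
Qed.
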